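(* Let $\mathscr{V}$ be a Hilbert $\mathscr{A}$-module over a $C^*$-algebra $\mathscr{A}$, let $\mathbb{L}(\mathscr{V})$ be its linking algebra, and let $x,y\in\mathscr{V}$. Then $$\Omega(x+y)\le \left\|\begin{bmatrix}\Omega(x)&\frac{1}{2}\left\|\begin{bmatrix}T_{\langle x,y\rangle}&0\\0&\theta_{x,y}\end{bmatrix}\right\|^{1/2}\\ \frac{1}{2}\left\|\begin{bmatrix}T_{\langle x,y\rangle}&0\\0&\theta_{x,y}\end{bmatrix}\right\|^{1/2}&\Omega(y)\end{bmatrix}\right\|\le \Omega(x)+\Omega(y),$$ where the inner norms are those of $\mathbb{L}(\mathscr{V})$ and the outer norm is the operator (spectral) norm of a $2\times 2$ real matrix.
   Context: $\mathscr{A}$ is a nonzero (not necessarily unital) complex $C^*$-algebra. A Hilbert $\mathscr{A}$-module $\mathscr{V}$ is a right $\mathscr{A}$-module with an $\mathscr{A}$-valued inner product $\langle\cdot,\cdot\rangle$ that is $\mathbb{C}$-linear and $\mathscr{A}$-linear in the second variable, so that $\langle x, ya\rangle=\langle x,y\rangle a$, and that satisfies $\langle x,y\rangle^*=\langle y,x\rangle$ and $\langle x,x\rangle\ge 0$ with equality iff $x=0$. It is complete in the norm $\|x\|=\|\langle x,x\rangle\|^{1/2}$. $\mathscr{A}$ is a Hilbert module over itself with $\langle a,b\rangle=a^*b$. For Hilbert $\mathscr{A}$-modules $\mathscr{V},\mathscr{W}$, $\mathbb{B}(\mathscr{V},\mathscr{W})$ is the space of adjointable maps and $\mathbb{K}(\mathscr{V},\mathscr{W})$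 is the closed linear span in it of the maps $\theta_{x,y}(z)=x\langle y,z\rangle$ ($x\in\mathscr{W}$, $y\in\mathscr{V}$); $\mathbb{K}(\mathscr{V})=\mathbb{K}(\mathscr{V},\mathscr{V})$. For $a\in\mathscr{A}$ let $T_a\in\mathbb{K}(\mathscr{A})$ be $T_a(b)=ab$. For $x\in\mathscr{V}$ let $r_x\in\mathbb{K}(\mathscr{A},\mathscr{V})$ be $r_x(a)=xa$ and $l_x\in\mathbb{K}(\mathscr{V},\mathscr{A})$ be $l_x(y)=\langle x,y\rangle$, so $r_x^*=l_x$. The linking algebra of $\mathscr{V}$ is the $C^*$-algebra $\mathbb{L}(\mathscr{V})=\left\{\begin{bmatrix} T_a & l_y\\ r_x & T\end{bmatrix}: a\in\mathscr{A},\ x,y\in\mathscr{V},\ T\in\mathbb{K}(\mathscr{V})\right\}=\mathbb{K}(\mathscr{A}\oplus\mathscr{V})$, acting on $\mathscr{A}\oplus\mathscr{V}$ by matrix multiplication on column vectors, with the operator norm. $\mathcal{S}(\mathbb{L}(\mathscr{V}))$ is the set of states (positive linear functionals of norm $1$) of $\mathbb{L}(\mathscr{V})$. The numerical radius of $x\in\mathscr{V}$ is $\Omega(x)=\sup\left\{\left|\varphi\left(\begin{bmatrix}0&0\\ r_x&0\end{bmatrix}\right)\right|:\varphi\in\mathcal{S}(\mathbb{L}(\mathscr{V}))\right\}$. *)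

(* Defs.v *)
From HB Require Import structures.
From mathcomp Require Import all_boot all_order all_algebra.
From mathcomp Require Import complex.
From mathcomp Require Import all_classical all_reals all_analysis.

Set Implicit Arguments.
Unset Strict Implicit.
Unset Printing Implicit Defensive.

Import Order.TTheory GRing.Theory Num.Theory.
Import numFieldNormedType.Exports.

Local Open Scope classical_set_scope.
Local Open Scope complex_scope.
Local Open Scope ring_scope.

(* Complex C*-algebras, not necessarily unital (hence not built on a ring
   structure) and possibly zero. *)
HB.mixin Record isCStarAlgebra (R : realType) (A : Type)
    of CompleteNormedModule R[i] A := {
  cmul : A -> A -> A;
  cstar : A -> A;
  cmulA : forall a b c, cmul a (cmul b c) = cmul (cmul a b) c;
  cmulDl : forall a b c, cmul (a + b) c = cmul a c + cmul b c;
  cmulDr : forall a b c, cmul a (b + c) = cmul a b + cmul a c;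
  cmulZl : forall (k : R[i]) a b, cmul (k *: a) b = k *: cmul a b;
  cmulZr : forall (k : R[i]) a b, cmul a (k *: b) = k *: cmul a b;
  cstarK : forall a, cstar (cstar a) = a;
  cstarD : forall a b, cstar (a + b) = cstar a + cstar b;
  cstarZ : forall (k : R[i]) a, cstar (k *: a) = (conjc k) *: cstar a;
  cstarM : forall a b, cstar (cmul a b) = cmul (cstar b) (cstar a);
  cnormM : forall a b, `|cmul a b| <= `|a| * `|b|;
  cnorm_star : forall a, `|cmul (cstar a) a| = `|a| ^+ 2
}.

#[short(type="cstarAlgType")]
HB.structure Definition CStarAlgebra (R : realType) :=
  {A of isCStarAlgebra R A & CompleteNormedModule R[i] A}.

(* Positivity in the form that needs no unitization. *)
Definition cpos (R : realType) (A : cstarAlgType R) (a : A) : Prop :=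
  exists b : A, a = cmul (cstar b) b.

(* Only the operations of an inner product A-module, without any axiom.
   Adjointable and compact maps and their norm are defined at this level so
   that they also make sense on the direct sum A (+) V, whose norm is not the
   max norm that the library puts on the product type A * V. *)
HB.mixin Record hasInner (R : realType) (A : cstarAlgType R) (V : Type)
    of GRing.Lmodule R[i] V := {
  ract : V -> A -> V;
  inner : V -> V -> A
}.

#[short(type="innerModType")]
HB.structure Definition InnerModule (R : realType) (A : cstarAlgType R) :=
  {V of hasInner R A V & GRing.Lmodule R[i] V}.

HB.mixin Record isHilbertModule (R : realType) (A : cstarAlgType R) (V : Type)
    of InnerModule R A V & CompleteNormedModule R[i] V := {
  ractDl : forall (x y : V) (a : A), ract (x + y) a = ract x a + ract y a;
  ractDr : forall (x : V) (a b : A), ract x (a + b) = ract x a + ract x b;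
  ractM : forall (x : V) (a b : A), ract x (cmul a b) = ract (ract x a) b;
  ractZl : forall (k : R[i]) (x : V) (a : A), ract (k *: x) a = k *: ract x a;
  ractZr : forall (k : R[i]) (x : V) (a : A), ract x (k *: a) = k *: ract x a;
  innerDr : forall x y z : V, inner x (y + z) = inner x y + inner x z :> A;
  innerZr : forall (k : R[i]) (x y : V), inner x (k *: y) = k *: inner x y :> A;
  inner_ract : forall (x y : V) (a : A), inner x (ract y a) = cmul (inner x y) a;
  inner_star : forall x y : V, cstar (inner x y) = inner y x :> A;
  inner_pos : forall x : V, cpos (inner x x : A);
  inner_eq0 : forall x : V, inner x x = 0 :> A -> x = 0;
  norm_inner : forall x : V, `|x| ^+ 2 = `|inner x x : A|
}.

#[short(type="hilbertModType")]
HB.structure Definition HilbertModule (R : realType) (A : cstarAlgType R) :=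
  {V of isHilbertModule R A V & InnerModule R A V & CompleteNormedModule R[i] V}.

#[non_forgetful_inheritance]
HB.instance Definition _ (R : realType) (A : cstarAlgType R) :=
  hasInner.Build R A (CStarAlgebra.sort A) cmul (fun a b => cmul (cstar a) b).

Section SelfModule.
Context (R : realType) (A : cstarAlgType R).

Fact self_star (a b : A) : cstar (inner a b : A) = inner b a.
Proof. by rewrite /inner /= cstarM cstarK. Qed.

Fact self_pos (a : A) : cpos (inner a a : A).
Proof. by exists a. Qed.

Fact self_norm (a : A) : `|a| ^+ 2 = `|inner a a : A|.
Proof. by rewrite /inner /= cnorm_star. Qed.

Fact self_eq0 (a : A) : inner a a = 0 :> A -> a = 0.
Proof.
move=> a0; apply/normr0_eq0/eqP.
by rewrite -sqrf_eq0 self_norm a0 normr0.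
Qed.

#[non_forgetful_inheritance]
HB.instance Definition _ :=
  isHilbertModule.Build R A (CStarAlgebra.sort A)
    (@cmulDl R A) (@cmulDr R A) (@cmulA R A) (@cmulZl R A)
    (fun k x a => @cmulZr R A k x a)
    (fun x => @cmulDr R A (cstar x)) (fun k x => @cmulZr R A k (cstar x))
    (fun x y a => @cmulA R A (cstar x) y a)
    self_star self_pos self_eq0 self_norm.

End SelfModule.

HB.instance Definition _ (R : realType) (A : cstarAlgType R)
    (V W : innerModType A) :=
  hasInner.Build R A (V * W)%type
    (fun z a => (ract z.1 a, ract z.2 a))
    (fun z w => inner z.1 w.1 + inner z.2 w.2).

Section Maps.
Context {R : realType} {A : cstarAlgType R}.
Implicit Types U V W : innerModType A.

Definition hnorm V (x : V) : R := Num.sqrt (complex.Re `|inner x x : A|).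

Definition opnorm V W (T : V -> W) : R :=
  sup [set hnorm (T z) | z in [set z : V | hnorm z <= 1]].

Definition adjoint V W (T : V -> W) (S : W -> V) : Prop :=
  forall z w, inner (T z) w = inner z (S w) :> A.

Definition adjointable V W (T : V -> W) : Prop := exists S, adjoint T S.

Definition theta V W (x : W) (y : V) : V -> W := fun z => ract x (inner y z : A).

Definition compact_map V W (T : V -> W) : Prop :=
  adjointable T /\
  forall e : R, 0 < e ->
    exists n (k : 'I_n -> R[i]) (x : 'I_n -> W) (y : 'I_n -> V),
      opnorm (T - \sum_(i < n) k i *: theta (x i) (y i)) < e.

Definition lmul (a : A) : A -> A := cmul a.
Definition rmap V (x : V) : A -> V := ract x.
Definition lmap V (x : V) : V -> A := inner x.

Definition blockop V W (T11 : V -> V) (T12 : W -> V) (T21 : V -> W)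
    (T22 : W -> W) : V * W -> V * W :=
  fun z => (T11 z.1 + T12 z.2, T21 z.1 + T22 z.2).

Definition linking V : set (A * V -> A * V) :=
  [set S | exists (a : A) (x y : V) (T : V -> V),
     compact_map T /\ S = blockop (lmul a) (lmap y) (rmap x) T].

(* A functional on L(V) is represented by a function on all self-maps of
   A (+) V of which only the values on L(V) matter.  Real suprema of unbounded
   sets being 0, the last condition entails that phi is bounded. *)
Definition state V (phi : (A * V -> A * V) -> R[i]) : Prop :=
  [/\ forall (k : R[i]) S T, linking S -> linking T ->
        phi (k *: S + T) = k * phi S + phi T,
      forall S S', linking S -> linking S' -> adjoint S S' ->
        0 <= phi (S' \o S)
    & sup [set complex.Re `|phi S| | S in [set S | linking S /\ opnorm S <= 1]]
        = 1].

Definition Omega V (x : V) : R :=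
  sup [set complex.Re `|phi (blockop 0 0 (rmap x) 0)| | phi in @state V].

End Maps.

Definition l2norm (R : realType) n (v : 'cV[R]_n) : R :=
  Num.sqrt (\sum_(i < n) v i 0 ^+ 2).

Definition specnorm (R : realType) m n (M : 'M[R]_(m, n)) : R :=
  sup [set l2norm (M *m v) | v in [set v : 'cV[R]_n | l2norm v <= 1]].

Definition mx22 (R : realType) (a b c d : R) : 'M[R]_2 :=
  \matrix_(i, j) if i == 0 then (if j == 0 then a else b)
                 else (if j == 0 then c else d).

(* Main.v *)
Require Import Defs.
From HB Require Import structures.
From mathcomp Require Import all_boot all_order all_algebra.
From mathcomp Require Import complex.
From mathcomp Require Import all_classical all_reals all_analysis.
From mathcomp Require Import ring lra.

(* The numerical radius of [[0, 0], [r_x, 0]], an element of square zero, is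
   half the norm of [x].  The lower bound is attained at a vector state built
   from a norming state of [A]; the upper bound holds because states are
   hermitian, so that they are estimated at the self-adjoint matrix
   [[0, l_x], [r_x, 0]], of norm [|x|].  The matrix of the theorem is therefore
   half of [[a, d], [d, b]], with [a = |x|], [b = |y|] and [d ^ 2] the norm of
   the product of the self-adjoint matrices [[0, l_x], [r_x, 0]] and
   [[0, l_y], [r_y, 0]].  Expanding powers of the sum of these two matrices into
   words bounds its norm, which is [|x + y|], by the top eigenvalue of
   [[a, d], [d, b]]; the second inequality says that [d ^ 2 <= a b].
   States and the Cauchy-Schwarz inequality rest on the positivity of [b^* b],
   which is obtained in the unitization by elementary norm estimates, without
   spectral theory. *)

Set Implicit Arguments.
Unset Strict Implicit.
Unset Printing Implicit Defensive.

Import Order.TTheory GRing.Theory Num.Theory.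
Import numFieldNormedType.Exports.
Local Open Scope classical_set_scope.
Local Open Scope complex_scope.
Local Open Scope ring_scope.

(** * Linear identities in a module *)

(** Two conventions of the definitions shape the proof. Adjointable maps are not assumed bounded,
    and the supremum of an unbounded set is 0, so [opnorm S <= 1] says nothing about [S] until
    adjointable maps are known to be bounded; hence a uniform boundedness argument. States are
    positive only on products [S' \o S], in an algebra that may lack a unit, so they are not
    hermitian for free: polarization reaches only vectors of the form [ract x u], and an approximate
    unit supplies the rest by density. The unitization acts on [A] by left multiplication, and the
    norm of this action is only a seminorm: if [A] has a unit [e], then [(1, -e)] acts as 0. In the
    estimate of [x + y], self-adjointness turns the growth rate of powers into the norm, and
    constant factors disappear under roots; any convenient norm on the direct sum will do. *)

Inductive lexp (K : Type) :=
  | LVar of nat | LZero | LAdd of lexp K & lexp K | LOpp of lexp K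
  | LScale of K & lexp K | LMuln of lexp K & nat.
Arguments LVar {K}.
Arguments LZero {K}.

Section LinearExpressions.
Context (K : pzRingType) (V : lmodType K).

Fixpoint leval (s : seq V) (e : lexp K) : V :=
  match e with
  | LVar i => nth 0 s i
  | LZero => 0
  | LAdd e1 e2 => leval s e1 + leval s e2
  | LOpp e1 => - leval s e1
  | LScale k e1 => k *: leval s e1
  | LMuln e1 n => leval s e1 *+ n
  end.

Fixpoint lcoef (e : lexp K) (i : nat) : K :=
  match e with
  | LVar j => if eqn i j then 1 else 0
  | LZero => 0
  | LAdd e1 e2 => lcoef e1 i + lcoef e2 i
  | LOpp e1 => - lcoef e1 i
  | LScale k e1 => k * lcoef e1 i
  | LMuln e1 n => n%:R * lcoef e1 i
  end.

Fixpoint same_coefs (e1 e2 : lexp K) (n : nat) : Prop :=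
  if n is n'.+1 then lcoef e1 n' = lcoef e2 n' /\ same_coefs e1 e2 n' else True.

Lemma leval_coef s e : leval s e = \sum_(i < size s) lcoef e i *: s`_i.
Proof.
elim: e => [j||e1 IH1 e2 IH2|e1 IH|k e1 IH|e1 IH n] /=.
- have E i : (if eqn i j then 1 else 0 : K) = (i == j)%:R.
    by rewrite eqnE; case: eqP.
  have [js|js] := ltnP j (size s).
    rewrite (bigD1 (Ordinal js)) //= E eqxx scale1r big1 ?addr0 // => i.
    by rewrite E -val_eqE /= => /negPf->; rewrite scale0r.
  rewrite nth_default // big1 // => i _; rewrite E ltn_eqF ?scale0r //.
  exact: leq_trans (ltn_ord i) js.
- by rewrite big1 // => i _; rewrite scale0r.
- by rewrite IH1 IH2 -big_split; apply: eq_bigr => i _; rewrite scalerDl.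
- by rewrite IH -sumrN; apply: eq_bigr => i _; rewrite scaleNr.
- by rewrite IH scaler_sumr; apply: eq_bigr => i _; rewrite scalerA.
- rewrite IH -scaler_nat scaler_sumr.
  by apply: eq_bigr => i _; rewrite scalerA.
Qed.

(** Reflection: comparing the coefficients of each atom turns a module identity into scalar
    identities, left to [ring] or [field]. *)
Lemma leval_eq s e1 e2 : same_coefs e1 e2 (size s) -> leval s e1 = leval s e2.
Proof.
move=> H; rewrite !leval_coef; apply: eq_bigr => i _; congr (_ *: _).
case: i => i /=; elim: (size s) H => //= n IH [Hn Hs].
by rewrite ltnS leq_eqVlt => /orP[/eqP->|/(IH Hs)].
Qed.

End LinearExpressions.

(* Equality of atoms up to the algebraic instances they carry, which may
   differ syntactically after rewriting. *)
Ltac lmod_same x y :=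
  first
  [ constr_eq x y
  | lazymatch x with
    | GRing.mul ?a ?b =>
        lazymatch y with GRing.mul ?c ?d => lmod_same a c; lmod_same b d end
    | GRing.add ?a ?b =>
        lazymatch y with GRing.add ?c ?d => lmod_same a c; lmod_same b d end
    | GRing.scale ?a ?b =>
        lazymatch y with GRing.scale ?c ?d => lmod_same a c; lmod_same b d end
    | GRing.exp ?a ?m =>
        lazymatch y with GRing.exp ?c ?n => constr_eq m n; lmod_same a c end
    | GRing.opp ?a => lazymatch y with GRing.opp ?c => lmod_same a c end
    | @GRing.one _ => lazymatch y with @GRing.one _ => idtac end
    | ?f ?a => lazymatch y with ?g ?b => lmod_same f g; lmod_same a b end
    end ].
Ltac lmod_find x s :=
  lazymatch s with
  | cons ?y ?s' =>
      match constr:(tt) with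
      | _ => let _ := match constr:(tt) with _ => lmod_same x y end in constr:(O)
      | _ => let n := lmod_find x s' in constr:(S n)
      end
  end.
Ltac lmod_add x s :=
  match constr:(tt) with
  | _ => let _ := lmod_find x s in s
  | _ => constr:(cons x s)
  end.
Ltac lmod_atoms e s :=
  lazymatch e with
  | GRing.add ?a ?b => let s' := lmod_atoms a s in lmod_atoms b s'
  | GRing.opp ?a => lmod_atoms a s
  | GRing.scale ?k ?a => lmod_atoms a s
  | GRing.natmul ?a ?n => lmod_atoms a s
  | @GRing.zero _ => s
  | _ => lmod_add e s
  end.
Ltac lmod_reify K e s :=
  lazymatch e with
  | GRing.add ?a ?b =>
      let a' := lmod_reify K a s in let b' := lmod_reify K b s in
      constr:(@LAdd K a' b')
  | GRing.opp ?a => let a' := lmod_reify K a s in constr:(@LOpp K a')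
  | GRing.scale ?k ?a => let a' := lmod_reify K a s in constr:(@LScale K k a')
  | GRing.natmul ?a ?n => let a' := lmod_reify K a s in constr:(@LMuln K a' n)
  | @GRing.zero _ => constr:(@LZero K)
  | _ => let n := lmod_find e s in constr:(@LVar K n)
  end.
Ltac lmod_prepare K V :=
  lazymatch goal with |- @eq ?T ?a ?b =>
    let s0 := constr:(@nil (GRing.Lmodule.sort V)) in
    let s1 := lmod_atoms a s0 in let s := lmod_atoms b s1 in
    let a' := lmod_reify K a s in let b' := lmod_reify K b s in
    refine (@leval_eq _ V s a' b' _);
    cbn [same_coefs lcoef size eqn]
  end.
(* Closes an identity between linear combinations in the left module [V] over
   the field [K]; every other subterm is an atom. *)
Tactic Notation "lmod" constr(K) constr(V) :=
  lmod_prepare K V; repeat split; try (by ring); try (by field).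

(** * Comparison of real numbers *)

Lemma ler_forall_addeps (R : realFieldType) (a b K : R) :
  (forall e, 0 < e -> e <= 1 -> a <= b + K * e) -> a <= b.
Proof.
move=> H; apply/ler_addgt0Pr => e e0.
have K1 : 0 < 1 + `|K| by rewrite ltr_wpDr.
pose d := Num.min 1 (e / (1 + `|K|)).
have d0 : 0 < d by rewrite lt_min ltr01 divr_gt0.
apply: le_trans (H d d0 _) _; first by rewrite ge_min lexx.
rewrite lerD2l; apply: le_trans (_ : (1 + `|K|) * d <= e).
  apply: ler_wpM2r; first exact: ltW.
  by rewrite (le_trans (ler_norm K)) // lerDr.
by rewrite mulrC -ler_pdivlMr // ge_min lexx orbT.
Qed.

Lemma bernoulli_ineq (R : realFieldType) (x : R) n : 0 <= x ->
  1 + n%:R * x <= (1 + x) ^+ n.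
Proof.
move=> x0; elim: n => [|n IH]; first by rewrite mul0r addr0.
rewrite exprS -natr1; apply: le_trans (_ : (1 + x) * (1 + n%:R * x) <= _).
  by have := mulr_ge0 (ler0n R n) (sqr_ge0 x); nra.
by rewrite ler_wpM2l // addr_ge0.
Qed.

Lemma expr_unbounded (R : realType) (q M : R) : 1 < q -> exists n, M < q ^+ n.
Proof.
move=> q1; have q0 : 0 < q - 1 by rewrite subr_gt0.
exists (Num.bound (`|M| / (q - 1))).
have := @archi_boundP R (`|M| / (q - 1)).
rewrite divr_ge0 ?(ltW q0) // ltr_pdivrMr // => /(_ isT) B.
apply: le_lt_trans (ler_norm M) _; apply: lt_le_trans B _.
have := bernoulli_ineq (Num.bound (`|M| / (q - 1))) (ltW q0).
rewrite [1 + (q - 1)]addrC subrK; apply: le_trans.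
by rewrite lerDr.
Qed.

(** If [q < p], the powers of [p / q] exceed every [C]. Exponents [2 ^ k] are those at which the
    C*-identity gives the norm of a power of a self-adjoint element. *)
Lemma le_of_exp_bound (R : realType) (p q C : R) : 0 <= p -> 0 < q ->
  (forall k, p ^+ (2 ^ k) <= C * q ^+ (2 ^ k)) -> p <= q.
Proof.
move=> p0 q0 pq; rewrite leNgt; apply/negP => qp.
have [|n nC] := @expr_unbounded R (p / q) C; first by rewrite ltr_pdivlMr // mul1r.
have := pq n; rewrite -ler_pdivrMr ?exprn_gt0 // -expr_div_n leNgt => /negP; apply.
apply: lt_le_trans nC _; apply: ler_weXn2l.
  by rewrite ler_pdivlMr // mul1r ltW.
by rewrite ltnW // ltn_expl.
Qed.

(** * Positive elements of unital algebras with a C*-seminorm *)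

(** The scalars are real, and the central element [ii] stands for the imaginary unit. Inequalities
    suffice in the last fields, since the reverse ones for scaling and for [star u * u] follow. *)
Record cstar_seminorm (R : realType) (B : algType R) (star : B -> B) (ii : B)
    (N : B -> R) : Prop := {
  cs_starK : forall u, star (star u) = u;
  cs_starD : forall u v, star (u + v) = star u + star v;
  cs_starM : forall u v, star (u * v) = star v * star u;
  cs_starZ : forall (t : R) u, star (t *: u) = t *: star u;
  cs_iiC : forall u, ii * u = u * ii;
  cs_ii2 : ii * ii = -1;
  cs_starii : star ii = - ii;
  cs_normD : forall u v, N (u + v) <= N u + N v;
  cs_normZ : forall (t : R) u, N (t *: u) <= `|t| * N u;
  cs_normM : forall u v, N (u * v) <= N u * N v;
  cs_norm_star : forall u, N u ^+ 2 <= N (star u * u)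
}.

Section CStarSeminorm.
Context (R : realType) (B : algType R) (star : B -> B) (ii : B) (N : B -> R).
Context (H : cstar_seminorm star ii N).
Implicit Types (u v a b c d h k : B) (t r e : R) (n : nat).

Let starK := cs_starK H.
Let starD := cs_starD H.
Let starM := cs_starM H.
Let starZ := cs_starZ H.
Let normD := cs_normD H.
Let normM := cs_normM H.

Definition selfadj u := star u = u.

Lemma star1 : star 1 = 1.
Proof. by rewrite -[RHS]starK -[star 1 in RHS]mul1r starM starK mul1r. Qed.

Lemma starN u : star (- u) = - star u.
Proof. by rewrite -scaleN1r starZ scaleN1r. Qed.

Lemma starB u v : star (u - v) = star u - star v.
Proof. by rewrite starD starN. Qed.

Lemma starA t : star t%:A = t%:A.
Proof. by rewrite starZ star1. Qed.

Lemma starX u n : star (u ^+ n) = star u ^+ n.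
Proof.
elim: n => [|n IH]; first by rewrite !expr0 star1.
by rewrite exprS starM IH exprSr.
Qed.

Lemma star0 : star 0 = 0.
Proof. by rewrite -(scale0r 1) starA. Qed.

Lemma snormZ t u : N (t *: u) = `|t| * N u.
Proof.
have [->|t0] := eqVneq t 0.
  apply/le_anti; rewrite (cs_normZ H) normr0 mul0r.
  have := normD (0 *: u) (0 *: u); rewrite !scale0r addr0 -[X in X <= _]addr0.
  by rewrite lerD2l.
apply/le_anti; rewrite (cs_normZ H) -ler_pdivlMl ?normr_gt0 // -normfV /=.
by rewrite -[u in X in X <= _](scalerK t0) (cs_normZ H).
Qed.

Lemma snorm0 : N 0 = 0.
Proof. by rewrite -(scale0r 1) snormZ normr0 mul0r. Qed.

Lemma snormN u : N (- u) = N u.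
Proof. by rewrite -scaleN1r snormZ normrN normr1 mul1r. Qed.

Lemma snorm_ge0 u : 0 <= N u.
Proof.
have := normD u (- u); rewrite subrr snorm0 snormN -mulr2n => N2.
by rewrite -(pmulrn_lge0 (N u) (isT : 0 < 2)%N).
Qed.

Lemma snormB u v : N (u - v) <= N u + N v.
Proof. by rewrite -(snormN v) normD. Qed.

Lemma snorm_sub u v : N u <= N (u - v) + N v.
Proof. by rewrite -[u in X in X <= _](subrK v) normD. Qed.

Lemma cdistC u v : N (u - v) = N (v - u).
Proof. by rewrite -snormN opprB. Qed.

Lemma snorm_starW u : N u <= N (star u).
Proof.
have [u0|u0] := eqVneq (N u) 0; first by rewrite u0 snorm_ge0.
have u1 : 0 < N u by rewrite lt_def u0 snorm_ge0.
by rewrite -(ler_pM2r u1) -expr2 (le_trans (cs_norm_star H u)).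
Qed.

Lemma snorm_star u : N (star u) = N u.
Proof.
apply/le_anti; rewrite snorm_starW andbT.
by rewrite (le_trans (snorm_starW _)) ?starK.
Qed.

Lemma snorm_starM u : N (star u * u) = N u ^+ 2.
Proof.
apply/le_anti; rewrite (cs_norm_star H) andbT.
by rewrite (le_trans (normM _ _)) // snorm_star expr2.
Qed.

Lemma snorm_sqr c : selfadj c -> N (c * c) = N c ^+ 2.
Proof. by move=> sc; rewrite -snorm_starM sc. Qed.

Lemma snorm1_le1 : N 1 <= 1.
Proof.
have := snorm_starM 1; rewrite star1 mulr1 => N1.
have [->//|N0] := eqVneq (N 1) 0.
by move/eqP: N1; rewrite expr2 -[X in X == _]mulr1 (inj_eq (mulfI N0)) => /eqP <-.
Qed.

Lemma snormA t : 0 <= t -> N t%:A <= t.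
Proof.
move=> t0; rewrite snormZ ger0_norm // -[X in _ <= X]mulr1.
by rewrite ler_wpM2l // snorm1_le1.
Qed.

Lemma snormX u n : N (u ^+ n) <= N u ^+ n.
Proof.
elim: n => [|n IH]; first by rewrite !expr0 snorm1_le1.
by rewrite !exprS (le_trans (normM _ _)) // ler_wpM2l // snorm_ge0.
Qed.

Lemma selfadjX c n : selfadj c -> selfadj (c ^+ n).
Proof. by move=> sc; rewrite /selfadj starX sc. Qed.

Lemma snormX2 c n : selfadj c -> N (c ^+ (2 ^ n)) = N c ^+ (2 ^ n).
Proof.
move=> sc; elim: n => [|n IH]; first by rewrite !expr1.
rewrite expnSr !exprM -IH expr2 snorm_sqr //; exact: selfadjX.
Qed.

(** In a unital C*-algebra this says that the spectrum lies in [[0, 2t]]; the norm condition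
    replaces any mention of a spectrum. *)
Definition cpositive h := selfadj h /\ exists t, N (t%:A - h) <= t.

Lemma cpositive_ge h t : cpositive h ->
  exists2 t', t <= t' & N (t'%:A - h) <= t'.
Proof.
case=> _ [r hr]; exists (r + `|t|).
  by rewrite (le_trans (ler_norm t)) // lerDr (le_trans _ hr) // snorm_ge0.
rewrite scalerDl -addrAC (le_trans (normD _ _)) // lerD //.
exact: snormA.
Qed.

Lemma cpositiveD h k : cpositive h -> cpositive k -> cpositive (h + k).
Proof.
case=> sh [t ht] [sk [r kr]]; split; first by rewrite /selfadj starD sh sk.
exists (t + r); rewrite scalerDl opprD addrACA (le_trans (normD _ _)) //.
exact: lerD.
Qed.

Lemma cpositiveZ t h : 0 <= t -> cpositive h -> cpositive (t *: h).
Proof.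
move=> t0 [sh [r hr]]; split; first by rewrite /selfadj starZ sh.
exists (t * r); rewrite -scalerA -scalerBr snormZ ger0_norm //.
exact: ler_wpM2l.
Qed.

Lemma cpositive_ball h r : selfadj h -> N h <= r -> cpositive (r%:A - h).
Proof.
move=> sh hr; split; first by rewrite /selfadj starB starA sh.
by exists r; rewrite opprB addrC subrK.
Qed.

Lemma cpositiveA t : 0 <= t -> cpositive t%:A.
Proof.
move=> t0; rewrite -[_%:A]subr0; apply: cpositive_ball; rewrite ?snorm0 //.
by rewrite /selfadj star0.
Qed.

Lemma cpositive0 : cpositive 0.
Proof. by rewrite -(scale0r 1); apply: cpositiveA. Qed.

Lemma cpositive1 : cpositive 1.
Proof. by rewrite -(scale1r 1); apply: cpositiveA. Qed.

Let iiC := cs_iiC H.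

Lemma star_circle c d : selfadj c -> selfadj d ->
  star (c + ii * d) = c - ii * d.
Proof. by move=> sc sd; rewrite starD starM (cs_starii H) sc sd mulrN iiC. Qed.

Lemma iiM_ii c d : (ii * c) * (ii * d) = - (c * d).
Proof. by rewrite -mulrA (mulrA c) -iiC !mulrA (cs_ii2 H) !mulN1r mulNr. Qed.

Lemma circle_star c d : c * d = d * c ->
  (c - ii * d) * (c + ii * d) = c * c + d * d.
Proof.
move=> cd; rewrite mulrDr !mulrBl iiM_ii opprK -!addrA; congr (_ + _).
by rewrite addrA mulrA -iiC -!mulrA cd addNr add0r.
Qed.

Lemma snorm_circle c d : selfadj c -> selfadj d -> c * d = d * c ->
  N (c + ii * d) ^+ 2 = N (c * c + d * d).
Proof. by move=> sc sd cd; rewrite -snorm_starM star_circle // circle_star. Qed.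

(** [c] is the real part of the normal element [c + ii * d], whose squared norm is the right-hand
    side. *)
Lemma snorm_sqrD c d : selfadj c -> selfadj d -> c * d = d * c ->
  N c ^+ 2 <= N (c * c + d * d).
Proof.
move=> sc sd cd; rewrite -snorm_circle // ler_pXn2r ?nnegrE ?snorm_ge0 //.
have c2 : 2 *: c = (c + ii * d) + star (c + ii * d).
  by rewrite star_circle // addrACA subrr addr0 scaler_nat mulr2n.
have : N (2 *: c) <= 2 * N (c + ii * d).
  by rewrite c2 (le_trans (normD _ _)) // snorm_star mulr_natl mulr2n.
by rewrite snormZ ger0_norm // ler_pM2l.
Qed.

(* Iteration for the root [1 - y] of [1 - a]: its limit solves
   [y = (a + y ^ 2) / 2]. *)
Fixpoint sqrt_iter a n : B :=
  if n is n'.+1 then 2^-1 *: (a + sqrt_iter a n' * sqrt_iter a n') else 0.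

Lemma sqrt_iterS a n :
  sqrt_iter a n.+1 = 2^-1 *: (a + sqrt_iter a n * sqrt_iter a n).
Proof. by []. Qed.

(** The same iteration at the scalar 1, used as a majorant. *)
Fixpoint rsqrt_iter n : R :=
  if n is n'.+1 then 2^-1 * (1 + rsqrt_iter n' ^+ 2) else 0.

Lemma sqrt_iter_selfadj a n : selfadj a -> selfadj (sqrt_iter a n).
Proof.
move=> sa; elim: n => [|n IH]; first exact: star0.
by rewrite /selfadj /= starZ starD starM sa IH.
Qed.

Lemma sqrt_iter_comm a v n : a * v = v * a ->
  sqrt_iter a n * v = v * sqrt_iter a n.
Proof.
move=> av; elim: n => [|n IH] /=; first by rewrite mul0r mulr0.
by rewrite -scalerAl -scalerAr mulrDl mulrDr av -mulrA IH mulrA IH mulrA.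
Qed.

Lemma rsqrt_iter_bound n : 0 <= rsqrt_iter n <= 1.
Proof. elim: n => [|n /andP[h1 h2]] /=; first by lra. by apply/andP; split; nra. Qed.

(** A gap [g] becomes [g - g ^ 2 / 2], which increases with [g] on [[0, 1]]; so [2 / m] is sent to
    [2 / m - 2 / m ^ 2], at most [2 / (m + 1)]. *)
Lemma rsqrt_iter_gap n : 1 - rsqrt_iter n <= 2 / n.+2%:R.
Proof.
elim: n => [|n IH] /=; first by rewrite divff ?subr0.
have /andP[h1 h2] := rsqrt_iter_bound n.
set s := rsqrt_iter n in IH h1 h2 *; rewrite -[n.+3]add1n natrD.
have n2 : (2 : R) <= n.+2%:R by rewrite ler_nat.
move: (n.+2%:R) n2 IH => m m2; rewrite !ler_pdivlMr ?ltr_wpDl //; try lra.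
nra.
Qed.

Lemma sqrt_iter_bound a n : N a <= 1 -> N (sqrt_iter a n) <= rsqrt_iter n.
Proof.
move=> a1; elim: n => [|n IH] /=; first by rewrite snorm0.
rewrite snormZ ger0_norm ?invr_ge0 // ler_wpM2l ?invr_ge0 //.
rewrite (le_trans (normD _ _)) // lerD // (le_trans (normM _ _)) // expr2.
by rewrite ler_pM // snorm_ge0.
Qed.

(** A difference of squares factors as [y' (y' - y) + (y' - y) y], so the increments obey the
    recursion of the scalar ones, with an inequality. *)
Lemma sqrt_iter_step a n : N a <= 1 ->
  N (sqrt_iter a n.+1 - sqrt_iter a n) <= rsqrt_iter n.+1 - rsqrt_iter n.
Proof.
move=> a1; elim: n => [|n IH].
  rewrite /= mulr0 !addr0 subr0 expr0n /= addr0 subr0 mulr1 snormZ.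
  by rewrite ger0_norm ?invr_ge0 // ler_piMr ?invr_ge0.
set y' := sqrt_iter a n.+1 in IH *; set y := sqrt_iter a n in IH *.
rewrite [sqrt_iter a n.+2]/= -/y' [X in _ - X](_ : y' = 2^-1 *: (a + y * y)) //.
rewrite -scalerBr opprD addrACA subrr add0r.
have -> : y' * y' - y * y = y' * (y' - y) + (y' - y) * y.
  by rewrite mulrBr mulrBl addrA subrK.
rewrite snormZ ger0_norm ?invr_ge0 //.
have y'1 := sqrt_iter_bound n.+1 a1; have y1 := sqrt_iter_bound n a1.
have N1 := normM y' (y' - y); have N2 := normM (y' - y) y.
have N3 := normD (y' * (y' - y)) ((y' - y) * y).
have := snorm_ge0 y'; have := snorm_ge0 y; have := snorm_ge0 (y' - y).
rewrite -/y' -/y in y'1 y1 *.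
have -> : rsqrt_iter n.+2 - rsqrt_iter n.+1 =
  2^-1 * ((rsqrt_iter n.+1 - rsqrt_iter n) * (rsqrt_iter n.+1 + rsqrt_iter n)).
  by rewrite /=; field.
move: (rsqrt_iter n.+1) (rsqrt_iter n) IH y'1 y1 => s' s IH y'1 y1 h1 h2 h3.
rewrite ler_wpM2l ?invr_ge0 //.
apply: le_trans (_ : N (y' - y) * (N y' + N y) <= _); first by lra.
by rewrite ler_pM ?addr_ge0 // lerD.
Qed.

(** For [s = 1 - y], with [y] the iterate number [n], the defect is twice the next increment, hence
    at most [(1 - rsqrt_iter n) ^ 2]. Commutation with the commutant of [a] is recorded so that
    roots of commuting elements commute. *)
Lemma sqrt_ball a e : selfadj a -> N a <= 1 -> 0 < e ->
  exists2 s, selfadj s /\ (forall v, a * v = v * a -> s * v = v * s)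
    & N (s * s - (1 - a)) <= e.
Proof.
move=> sa a1 e0.
have [n ne] : exists n : nat, 2 / e < n%:R.
  by exists (Num.bound (2 / e)); apply: archi_boundP; rewrite ltW // divr_gt0.
pose y := sqrt_iter a n; exists (1 - y); first split.
- by rewrite /selfadj starB star1 sqrt_iter_selfadj.
- by move=> v av; rewrite mulrBl mulrBr mul1r mulr1 sqrt_iter_comm.
have -> : (1 - y) * (1 - y) - (1 - a) = 2 *: (sqrt_iter a n.+1 - y).
  rewrite sqrt_iterS -/y mulrBl mul1r mulrBr mulr1.
  by lmod R B.
have := sqrt_iter_step n a1; have := rsqrt_iter_gap n.
have /andP[] := rsqrt_iter_bound n.
have : 2 / n.+2%:R <= e.
  rewrite ler_pdivrMr // mulrC -ler_pdivrMr // (le_trans (ltW ne)) // ler_nat.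
  by rewrite leqW.
rewrite snormZ ger0_norm // [rsqrt_iter n.+1]/= -/y.
move: (N _) (rsqrt_iter n) (2 / _) => D s w we s0 s1 g1 st; nra.
Qed.

Lemma cpositive_sqrt h e : cpositive h -> 0 < e ->
  exists2 c, selfadj c /\ (forall v, h * v = v * h -> c * v = v * c)
    & N (c * c - h) <= e.
Proof.
move=> ph e0; have [t t1 ht] := cpositive_ge 1 ph.
have t0 : 0 < t by rewrite (lt_le_trans ltr01).
have [sh _] := ph; pose a := 1 - t^-1 *: h.
have [|||s [ss sC] se] := @sqrt_ball a (e / t).
- by rewrite /selfadj starB star1 starZ sh.
- have -> : a = t^-1 *: (t%:A - h).
    by rewrite scalerBr scalerA mulVf ?scale1r // gt_eqF.
  by rewrite snormZ ger0_norm ?invr_ge0 ?(ltW t0) // ler_pdivrMl // mulr1.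
- exact: divr_gt0.
exists (Num.sqrt t *: s); first split.
- by rewrite /selfadj starZ ss.
- move=> v hv; rewrite -scalerAl -scalerAr sC // /a mulrBl mulrBr mul1r mulr1.
  by rewrite -scalerAl -scalerAr hv.
have -> : (Num.sqrt t *: s) * (Num.sqrt t *: s) - h = t *: (s * s - (1 - a)).
  rewrite -scalerAl -scalerAr scalerA -expr2 sqr_sqrtr ?(ltW t0) //.
  by rewrite subKr scalerBr scalerA divff ?scale1r // gt_eqF.
by rewrite snormZ gtr0_norm // -ler_pdivlMl // mulrC.
Qed.

(** Double angle formula: with [d] an approximate root of [1 - c ^ 2], the element [u = c + ii * d]
    is nearly unitary and the real part of [u ^ 2] is nearly [2 c ^ 2 - 1], which thus has norm at
    most 1. *)
Lemma snorm_1_sqr c : selfadj c -> N c <= 1 -> N (1 - c * c) <= 1.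
Proof.
move=> sc c1; suff P : N (2 *: (c * c) - 1) <= 1.
  have -> : 1 - c * c = 2^-1 *: (1 - (2 *: (c * c) - 1)) by lmod R B.
  rewrite snormZ ger0_norm ?invr_ge0 // ler_pdivrMl //.
  by apply: le_trans (snormB _ _) _; have := snorm1_le1; lra.
apply: (@ler_forall_addeps _ _ _ 2) => e e0 _.
have [||d [sd dC] dE] := @sqrt_ball (c * c) e _ _ e0.
- by rewrite /selfadj starM sc.
- by rewrite snorm_sqr // expr_le1 // snorm_ge0.
have cd : c * d = d * c by rewrite dC // mulrA.
pose u := c + ii * d; pose w := d * d - (1 - c * c).
have u2 : N u ^+ 2 <= 1 + e.
  rewrite snorm_circle //; have -> : c * c + d * d = 1 + w by rewrite /w; lmod R B.
  by rewrite (le_trans (normD _ _)) // lerD // snorm1_le1.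
have uu : u * u + star u * star u = 2 *: (2 *: (c * c) - 1 - w).
  rewrite /u /w star_circle // !(mulrDl, mulrDr, mulNr, mulrN) !iiM_ii.
  by lmod R B.
have : N (u * u + star u * star u) <= 2 * (1 + e).
  rewrite (le_trans (normD _ _)) // mulr_natl mulr2n lerD //.
    by rewrite (le_trans (normM _ _)) // -expr2.
  by rewrite (le_trans (normM _ _)) // snorm_star -expr2.
rewrite uu snormZ ger0_norm // ler_pM2l // => uu1.
have := snorm_sub (2 *: (c * c) - 1) w; rewrite cdistC.
have -> : N (w - (2 *: (c * c) - 1)) = N (2 *: (c * c) - 1 - w) by rewrite cdistC.
move=> W; apply: le_trans W _; rewrite -/w in dE; lra.
Qed.

Lemma cpositive_sqr c : selfadj c -> cpositive (c * c).
Proof.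
move=> sc; pose r := 1 + N c; have Nc := snorm_ge0 c.
have r0 : 0 < r by rewrite /r; lra.
have -> : c * c = r ^+ 2 *: ((r^-1 *: c) * (r^-1 *: c)).
  rewrite -scalerAl -scalerAr !scalerA (_ : _ * _ * _ = 1) ?scale1r //.
  by field; rewrite gt_eqF.
apply: cpositiveZ; first exact: sqr_ge0.
have sc' : selfadj (r^-1 *: c) by rewrite /selfadj starZ sc.
split; first by rewrite /selfadj starM sc'.
exists 1; rewrite scale1r; apply: snorm_1_sqr => //.
by rewrite snormZ gtr0_norm ?invr_gt0 // ler_pdivrMl // mulr1 /r lerDr.
Qed.

(** With commuting approximate roots [c] of [h] and [d] of [t - h], the norm of [c ^ 2] is at most
    that of [c ^ 2 + d ^ 2], which is close to [t]. *)
Lemma snorm_le h t : 0 <= t -> cpositive h -> cpositive (t%:A - h) -> N h <= t.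
Proof.
move=> t0 ph pth; apply: (@ler_forall_addeps _ _ _ 3) => e e0 _.
have [c [sc cC] ce] := cpositive_sqrt ph e0.
have [d [sd dC] de] := cpositive_sqrt pth e0.
have hA : h * t%:A = t%:A * h by rewrite -scalerAl -scalerAr mul1r mulr1.
have cd : c * d = d * c.
  apply/esym/dC; rewrite mulrBl mulrBr (cC h) //.
  by rewrite -scalerAl -scalerAr mul1r mulr1.
have N1 := snorm_sqrD sc sd cd.
have N2 : N (c * c + d * d) <= t + 2 * e.
  have -> : c * c + d * d = t%:A + ((c * c - h) + (d * d - (t%:A - h))).
    by lmod R B.
  rewrite (le_trans (normD _ _)) // lerD ?snormA // (le_trans (normD _ _)) //.
  by rewrite mulr_natl mulr2n lerD.
have := snorm_sub h (c * c); rewrite cdistC snorm_sqr //; lra.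
Qed.

Lemma cpositive_dist h t : cpositive h -> N h <= t -> N (t%:A - h) <= t.
Proof.
move=> ph ht; have t0 := le_trans (snorm_ge0 h) ht.
apply: snorm_le => //; first by apply: cpositive_ball => //; case: ph.
by rewrite opprB addrC subrK.
Qed.

(** The radius witnessing positivity could vary with the approximant [g]; by [cpositive_dist] any
    bound of [N g] serves, so [N h + 1] works for all of them. *)
Lemma cpositive_closed h : selfadj h ->
  (forall e, 0 < e -> exists2 g, cpositive g & N (g - h) <= e) -> cpositive h.
Proof.
move=> sh cl; split=> //; exists (N h + 1).
apply: (@ler_forall_addeps _ _ _ 1) => e e0 e1; rewrite mul1r.
have [g pg gh] := cl e e0.
have gN : N g <= N h + 1.
  by rewrite (le_trans (snorm_sub g h)) // addrC lerD // (le_trans gh).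
have := cpositive_dist pg gN => N1.
have -> : (N h + 1)%:A - h = ((N h + 1)%:A - g) + (g - h) by lmod R B.
by rewrite (le_trans (normD _ _)) // lerD.
Qed.

Lemma cpositiveM h k : cpositive h -> cpositive k -> h * k = k * h ->
  cpositive (h * k).
Proof.
move=> ph pk hk; have [sh _] := ph; have [sk _] := pk.
apply: cpositive_closed => [|e e0]; first by rewrite /selfadj starM sh sk hk.
pose K := N h + N k + 1.
have Nh := snorm_ge0 h; have Nk := snorm_ge0 k.
have K0 : 0 < K by rewrite /K; lra.
pose f := Num.min 1 (e / K).
have f0 : 0 < f by rewrite lt_min ltr01 divr_gt0.
have f1 : f <= 1 by rewrite ge_min lexx.
have fe : f * K <= e by rewrite -ler_pdivlMr // ge_min lexx orbT.
have [c [sc cC] ce] := cpositive_sqrt ph f0.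
have [d [sd dC] de] := cpositive_sqrt pk f0.
have cd : c * d = d * c by apply/esym/dC; rewrite cC.
exists ((c * d) * (c * d)).
  by apply: cpositive_sqr; rewrite /selfadj starM sc sd cd.
have -> : c * d * (c * d) - h * k = (c * c - h) * (d * d) + h * (d * d - k).
  by rewrite mulrBl mulrBr -mulrA (mulrA d) -cd !mulrA; lmod R B.
rewrite (le_trans (normD _ _)) // (le_trans _ fe) //.
have dd : N (d * d) <= N k + 1.
  by rewrite (le_trans (snorm_sub _ k)) // addrC lerD // (le_trans de).
have N1 : N ((c * c - h) * (d * d)) <= f * (N k + 1).
  by rewrite (le_trans (normM _ _)) // ler_pM // snorm_ge0.
have N2 : N (h * (d * d - k)) <= N h * f.
  by rewrite (le_trans (normM _ _)) // ler_wpM2l.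
rewrite /K; lra.
Qed.

Lemma snorm_mono h k : cpositive h -> cpositive k -> N h <= N (h + k).
Proof.
move=> ph pk; apply: snorm_le => //; first exact: snorm_ge0.
have -> : (N (h + k))%:A - h = ((N (h + k))%:A - (h + k)) + k by lmod R B.
apply: cpositiveD => //; apply: cpositive_ball => //.
by case: (cpositiveD ph pk).
Qed.

Lemma cpositiveX h n : cpositive h -> cpositive (h ^+ n).
Proof.
move=> ph; elim: n => [|n IH]; first by rewrite expr0; exact: cpositive1.
by rewrite exprS; apply: cpositiveM => //; rewrite -exprS exprSr.
Qed.

Lemma cpositive_sum (I : Type) (s : seq I) (P : pred I) (F : I -> B) :
  (forall i, P i -> cpositive (F i)) -> cpositive (\sum_(i <- s | P i) F i).
Proof.
by move=> PF; apply: big_ind => //; [exact: cpositive0|exact: cpositiveD].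
Qed.

(** * Positivity of [b^* b] *)

Lemma selfadj_starM b : selfadj (star b * b).
Proof. by rewrite /selfadj starM starK. Qed.

(** Up to the factor 2, [c] and [d] below are the real and imaginary parts of [b], up to sign; the
    sum is a combination of their squares. *)
Lemma cpositive_star_sym b : cpositive (star b * b + b * star b).
Proof.
pose c := b + star b; pose d := ii * (b - star b).
have sc : selfadj c by rewrite /selfadj starD starK addrC.
have sd : selfadj d.
  by rewrite /selfadj starM starB starK (cs_starii H) mulrN -mulNr opprB -iiC.
have -> : star b * b + b * star b = 2^-1 *: (c * c + d * d).
  by rewrite iiM_ii /c !(mulrDl, mulrDr, mulNr, mulrN); lmod R B.
apply: cpositiveZ; first by rewrite invr_ge0.
by apply: cpositiveD; exact: cpositive_sqr.
Qed.

(* [1 - h ^ n + h ^ (n + 1) = h + (1 - h) ^ 2 (1 + h + ... + h ^ (n - 1))]. *)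
Lemma cpositive_1_expr h n : cpositive h ->
  cpositive (1 - h ^+ n + h ^+ n.+1).
Proof.
move=> ph; pose s := \sum_(i < n) h ^+ i.
have sE : (1 - h) * s = 1 - h ^+ n by rewrite -opprB mulNr -subrX1 opprB.
have -> : 1 - h ^+ n + h ^+ n.+1 = h + (1 - h) * (1 - h) * s.
  rewrite -mulrA sE mulrBl mul1r mulrBr mulr1 -exprS.
  by lmod R B.
have [sh _] := ph; apply: cpositiveD => //; apply: cpositiveM.
- by apply: cpositive_sqr; rewrite /selfadj starB star1 sh.
- by apply: cpositive_sum => i _; exact: cpositiveX.
have hs : GRing.comm (1 - h) s.
  apply: commr_sum => i _; apply/commrX/commr_sym.
  by apply: commrB => //; exact: commr1.
by apply: commr_sym; apply: commrM; apply: commr_sym.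
Qed.

(* If [m = 1 - b^* b] had norm above 1, then [x = b m ^ n] would make
   [x^* x + x x^* >= 0] fail: its first summand is [m ^ 2n (1 - m)], while
   the second one, a polynomial in [1 - b b^*], is at most 1. *)
Lemma snorm_1_starM b : N b <= 1 -> N (1 - star b * b) <= 1.
Proof.
move=> b1.
have starM_le c : N c <= 1 -> N (star c * c) <= 1.
  by move=> c1; rewrite snorm_starM expr_le1 // snorm_ge0.
have ball c : N c <= 1 -> cpositive (1 - star c * c).
  move=> c1; rewrite -[X in X - _](scale1r (1 : B)).
  by apply: cpositive_ball; [exact: selfadj_starM|exact: starM_le].
set m := 1 - _; have pm : cpositive m by apply: ball.
pose m' := 1 - b * star b.
have pm' : cpositive m' by rewrite /m' -{1}(starK b); apply: ball; rewrite snorm_star.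
have bm n : b * m ^+ n = m' ^+ n * b.
  elim: n => [|n IH]; first by rewrite !expr0 mulr1 mul1r.
  rewrite exprS mulrA (_ : b * m = m' * b); last first.
    by rewrite mulrBr mulrBl mulr1 mul1r mulrA.
  by rewrite -mulrA IH mulrA -exprS.
have [sm _] := pm; have mX := selfadjX _ sm.
have claim n : N (m ^+ n.*2.+1) <= 1 + N m ^+ n.*2.
  apply: snorm_le; last 1 first.
  - have -> : (1 + N m ^+ n.*2)%:A - m ^+ n.*2.+1 =
      ((N m ^+ n.*2)%:A - m ^+ n.*2) + ((1 - m' ^+ n.*2 + m' ^+ n.*2.+1) +
      ((m ^+ n.*2 - m ^+ n.*2.+1) + (m' ^+ n.*2 - m' ^+ n.*2.+1))) by lmod R B.
    apply: cpositiveD; last first.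
      apply: cpositiveD; first exact: cpositive_1_expr.
      have := cpositive_star_sym (b * m ^+ n); rewrite starM mX.
      have -> : m ^+ n * star b * (b * m ^+ n) = m ^+ n.*2 - m ^+ n.*2.+1.
        rewrite -mulrA (mulrA (star b)) (_ : star b * b = 1 - m); last first.
          by rewrite subKr.
        by rewrite mulrBl mul1r mulrBr -exprS -!exprD addnS addnn.
      have -> // : b * m ^+ n * (m ^+ n * star b) = m' ^+ n.*2 - m' ^+ n.*2.+1.
        rewrite mulrA -(mulrA b) -exprD addnn bm -mulrA.
        rewrite (_ : b * star b = 1 - m'); last by rewrite subKr.
        by rewrite mulrBr mulr1 -exprSr.
    by apply: cpositive_ball; [exact: mX|exact: snormX].
  - by rewrite addr_ge0 // exprn_ge0 // snorm_ge0.
  - exact: cpositiveX.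
rewrite leNgt; apply/negP => l1; set l := N m in l1 claim.
have l0 : 0 < l by rewrite (lt_trans ltr01).
(* With [n = 2 ^ k - 1], the exponent [2n + 2] is a power of 2, where the norm of the power is
   exactly the power of [l]; [claim] then gives [l ^ (2n + 1) <= 1 + l ^ 2n], impossible for large
   [k] if [l > 1]. *)
have P (k : nat) : l ^+ (2 ^ k - 1).*2 * (l - 1) <= 1.
  have := claim (2 ^ k - 1)%N; set n := (_ - 1)%N => cl.
  have En : (2 ^ k.+1 = n.*2.+2)%N.
    by rewrite -doubleS /n subn1 prednK ?expn_gt0 // expnS mul2n.
  have := snormX2 k.+1 sm; rewrite En (exprS m) (exprS (N m)) => E.
  have : l * l ^+ n.*2.+1 <= l * (1 + l ^+ n.*2).
    by rewrite -E (le_trans (normM _ _)) // ler_pM2l.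
  by rewrite ler_pM2l // exprS mulrBr mulr1 => W; rewrite mulrC lerBlDr.
have [n nP] := @expr_unbounded R l (l - 1)^-1 l1.
have l10 : 0 < l - 1 by rewrite subr_gt0.
have := P n; rewrite leNgt => /negP; apply.
rewrite -ltr_pdivrMr // div1r (lt_le_trans nP) // ler_weXn2l ?(ltW l1) //.
rewrite -addnn (leq_trans _ (leq_addr _ _)) // leq_subRL ?expn_gt0 //.
by rewrite add1n ltn_expl.
Qed.

Lemma cpositive_starM b : cpositive (star b * b).
Proof.
pose r := 1 + N b; have Nb := snorm_ge0 b.
have r0 : 0 < r by rewrite /r; lra.
have -> : star b * b = r ^+ 2 *: (star (r^-1 *: b) * (r^-1 *: b)).
  rewrite starZ -scalerAl -scalerAr !scalerA (_ : _ * _ * _ = 1) ?scale1r //.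
  by field; rewrite gt_eqF.
apply: cpositiveZ; first exact: sqr_ge0.
split; first exact: selfadj_starM.
exists 1; rewrite scale1r; apply: snorm_1_starM.
by rewrite snormZ gtr0_norm ?invr_gt0 // ler_pdivrMl // mulr1 /r lerDr.
Qed.

Lemma cpositive_conj h c : cpositive h -> cpositive (star c * h * c).
Proof.
move=> ph; have [sh _] := ph.
apply: cpositive_closed => [|e e0].
  by rewrite /selfadj !starM starK sh mulrA.
have Nc := snorm_ge0 c; have K0 : 0 < 1 + N c ^+ 2 by nra.
have [s [ss _] se] := cpositive_sqrt ph (divr_gt0 e0 K0).
exists (star (s * c) * (s * c)); first exact: cpositive_starM.
have -> : star (s * c) * (s * c) - star c * h * c = star c * (s * s - h) * c.
  by rewrite starM ss mulrBr mulrBl !mulrA.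
rewrite (le_trans (normM _ _)) // (le_trans (ler_wpM2r Nc (normM _ _))) //.
rewrite snorm_star mulrAC -expr2 (le_trans (ler_wpM2l (sqr_ge0 _) se)) //.
rewrite mulrCA ler_piMr ?(ltW e0) // ler_pdivrMr // mul1r.
by rewrite lerDr.
Qed.

(** The analogue of [n t (1 - t) ^ n <= 1] on [[0, 1]]: the telescoping sum of the [h m ^ i],
    [i < n], is [1 - m ^ n], and each of its terms dominates [h m ^ n]. *)
Lemma snorm_decay h n : cpositive h -> N h <= 1 ->
  n%:R * N (h * (1 - h) ^+ n) <= 1.
Proof.
move=> ph h1; have [sh _] := ph; set m := 1 - h.
have m1 : N m <= 1.
  by rewrite /m -[X in X - _](scale1r (1 : B)); exact: cpositive_dist.
have sm : selfadj m by rewrite /selfadj starB star1 sh.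
have pm : cpositive m.
  rewrite /m -[X in X - _](scale1r (1 : B)); exact: cpositive_ball.
have mX (k : nat) : cpositive (1 - m ^+ k).
  rewrite -[X in X - _](scale1r (1 : B)).
  apply: cpositive_ball; first exact: selfadjX.
  by rewrite (le_trans (snormX _ _)) // exprn_ile1 // snorm_ge0.
have hm : GRing.comm h m by apply: commrB => //; exact: commr1.
have mm (k : nat) : GRing.comm m (1 - m ^+ k).
  by apply: commrB; [exact: commr1|exact: commrX].
have hmk (k : nat) : GRing.comm h (1 - m ^+ k).
  by apply: commrB; [exact: commr1|exact: commrX].
have sumE : \sum_(i < n) h * m ^+ i = 1 - m ^+ n.
  by rewrite -mulr_sumr -[h](subKr 1) -/m -opprB mulNr -subrX1 opprB.
have -> : n%:R * N (h * m ^+ n) = N (\sum_(i < n) h * m ^+ n).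
  by rewrite sumr_const card_ord -(scaler_nat n (h * m ^+ n : B)) snormZ ger0_norm.
apply: le_trans (_ : N (1 - m ^+ n) <= 1); last first.
  rewrite -[X in X - _](scale1r (1 : B)); apply: cpositive_dist.
    exact: cpositiveX.
  by rewrite (le_trans (snormX _ _)) // exprn_ile1 // snorm_ge0.
(* Needed for [k = 0], where it gives [h m ^ n], and for [k = 1], [j = n - i], where it gives
   [h m ^ i - h m ^ n]. *)
have pos (i j k : nat) : cpositive (h * m ^+ i * (1 - m ^+ j) ^+ k).
  apply: cpositiveM; [|exact: cpositiveX|].
    by apply: cpositiveM => //; [exact: cpositiveX|exact: commrX].
  apply: commrX; apply: commr_sym; apply: commrM; apply: commr_sym => //.
  exact/commr_sym/commrX/commr_sym.
rewrite -sumE -[\sum_(i < n) h * m ^+ i](addrNK (\sum_(i < n) h * m ^+ n)) addrC.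
apply: snorm_mono.
  apply: cpositive_sum => i _; have := pos n 0%N 0%N.
  by rewrite expr0 mulr1.
rewrite -sumrB; apply: cpositive_sum => i _; have := pos i (n - i)%N 1%N.
by rewrite expr1 mulrBr mulr1 -mulrA -exprD subnKC // ltnW.
Qed.
End CStarSeminorm.

(** * Norms *)

Section RealNorm.
Context (R : realType).

Definition rnorm (V : normedModType R[i]) (x : V) : R := complex.Re `|x|.

Lemma rnormE (V : normedModType R[i]) (x : V) : (rnorm x)%:C = `|x|.
Proof. by apply: RRe_real; rewrite normr_real. Qed.

Definition cmod (k : R[i]) : R := complex.Re `|k|.

Lemma cmodE (k : R[i]) : (cmod k)%:C = `|k|.
Proof. by apply: RRe_real; rewrite normr_real. Qed.

Lemma cmod_real (t : R) : cmod t%:C = `|t|.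
Proof.
apply: (@complexI R); rewrite cmodE.
by rewrite normc_def /= expr0n /= addr0 sqrtr_sqr.
Qed.

Lemma cmod_ge0 k : 0 <= cmod k.
Proof. by rewrite -ler0c cmodE. Qed.

Lemma cmodM k l : cmod (k * l) = cmod k * cmod l.
Proof. by apply: (@complexI R); rewrite rmorphM /= !cmodE normrM. Qed.

Lemma cmodJ k : cmod (conjc k) = cmod k.
Proof. by rewrite /cmod normcJ. Qed.

Lemma exists_phase (k : R[i]) :
  exists2 w : R[i], cmod w = 1 & w * k = (cmod k)%:C.
Proof.
have [->|k0] := eqVneq k 0.
  by exists 1; rewrite ?mulr0 /cmod ?normr0 // normr1.
have n0 : `|k| != 0 by rewrite normr_eq0.
exists (conjc k / `|k|); last first.
  by rewrite mulrAC (mulrC (conjc _)) -sqr_normc cmodE expr2 mulfK.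
apply: (@complexI R); rewrite cmodE normrM normcJ normfV normr_id.
by rewrite divff // rmorph1.
Qed.

Context (V : normedModType R[i]).
Implicit Types (x y : V) (k : R[i]) (t : R).

Lemma rnorm_ge0 x : 0 <= rnorm x.
Proof. by rewrite -ler0c rnormE. Qed.

Lemma rnorm0 : rnorm (0 : V) = 0.
Proof. by rewrite /rnorm normr0. Qed.

Lemma rnorm_eq0 x : rnorm x = 0 -> x = 0.
Proof. by move=> x0; apply: normr0_eq0; rewrite -rnormE x0. Qed.

Lemma rnormD x y : rnorm (x + y) <= rnorm x + rnorm y.
Proof. by rewrite -lecR rmorphD /= !rnormE ler_normD. Qed.

Lemma rnormZ k x : rnorm (k *: x) = cmod k * rnorm x.
Proof. by apply: (@complexI R); rewrite rmorphM /= cmodE !rnormE normrZ. Qed.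

Lemma rnormN x : rnorm (- x) = rnorm x.
Proof. by rewrite /rnorm normrN. Qed.

End RealNorm.

Section CStarNorm.
Context (R : realType) (A : cstarAlgType R).
Implicit Types (a b : A).

Lemma rnormM a b : rnorm (cmul a b) <= rnorm a * rnorm b.
Proof. by rewrite -lecR rmorphM /= !rnormE cnormM. Qed.

Lemma rnorm_starM a : rnorm (cmul (cstar a) a) = rnorm a ^+ 2.
Proof. by apply: (@complexI R); rewrite rmorphXn /= !rnormE cnorm_star. Qed.

Lemma rnorm_star a : rnorm (cstar a) = rnorm a.
Proof.
have le b : rnorm b <= rnorm (cstar b).
  have [->|b0] := eqVneq (rnorm b) 0; first exact: rnorm_ge0.
  have b1 : 0 < rnorm b by rewrite lt_def b0 rnorm_ge0.
  by rewrite -(ler_pM2r b1) -expr2 -rnorm_starM rnormM.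
by apply/le_anti; rewrite le andbT -{2}(cstarK a) le.
Qed.

Lemma cstar0 : cstar (0 : A) = 0.
Proof. by rewrite -(scale0r (0 : A)) cstarZ conjc0 !scale0r. Qed.

Lemma cmul0l a : cmul 0 a = 0.
Proof. by rewrite -(scale0r (0 : A)) cmulZl !scale0r. Qed.

Lemma cmul0r a : cmul a 0 = 0.
Proof. by rewrite -(scale0r (0 : A)) cmulZr !scale0r. Qed.

Lemma cmulNl a b : cmul (- a) b = - cmul a b.
Proof. by rewrite -scaleN1r cmulZl scaleN1r. Qed.

Lemma cmulNr a b : cmul a (- b) = - cmul a b.
Proof. by rewrite -scaleN1r cmulZr scaleN1r. Qed.

End CStarNorm.

(** * Operator norms of bounded maps *)

Section OperatorNorm.
Context (R : realType) (A : cstarAlgType R) (V W : innerModType A).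
Implicit Types (T : V -> W) (z : V) (M t : R).

Lemma opnorm_le T M : 0 <= M -> (forall z, hnorm (T z) <= M * hnorm z) ->
  opnorm T <= M.
Proof.
move=> M0 TM; rewrite /opnorm; set S := (X in sup X).
have [->|/set0P S0] := eqVneq S set0; first by rewrite sup0.
apply: ge_sup => // _ [z /= z1 <-].
by rewrite (le_trans (TM z)) // ler_piMr.
Qed.

(** The bound [M] makes the supremum a genuine one: for an unbounded map [opnorm] would be 0. *)
Lemma le_opnorm T M :
  (forall t z, hnorm (t%:C *: z) = `|t| * hnorm z) ->
  (forall t z, hnorm (T (t%:C *: z)) = `|t| * hnorm (T z)) ->
  (forall z, hnorm (T z) <= M * hnorm z) ->
  forall z, hnorm (T z) <= opnorm T * hnorm z.
Proof.
move=> hV hT TM z.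
have [z0|z0] := eqVneq (hnorm z) 0.
  by rewrite z0 mulr0 (le_trans (TM z)) // z0 mulr0.
have z1 : 0 < hnorm z by rewrite lt_def z0 sqrtr_ge0.
rewrite -ler_pdivrMr // mulrC -(ger0_norm (ltW _ : 0 <= (hnorm z)^-1)) ?invr_gt0 //.
rewrite -hT; apply: ub_le_sup.
  exists `|M| => _ [y /= y1 <-]; rewrite (le_trans (TM y)) //.
  rewrite (le_trans (ler_wpM2r (sqrtr_ge0 _) (ler_norm M))) //.
  by rewrite ler_piMr.
exists ((hnorm z)^-1%:C *: z) => //=.
by rewrite hV ger0_norm ?invr_ge0 ?(ltW z1) // mulVf.
Qed.

Lemma opnorm_ge0 T M : (forall z, hnorm (T z) <= M * hnorm z) -> 0 <= opnorm T.
Proof.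
move=> TM; rewrite /opnorm; set S := (X in sup X).
have [->|/set0P[_ [z zS _]]] := eqVneq S set0; first by rewrite sup0.
rewrite (le_trans (sqrtr_ge0 _ : 0 <= hnorm (T z))) //.
apply: ub_le_sup; last by exists z.
exists `|M| => _ [y /= y1 <-]; rewrite (le_trans (TM y)) //.
rewrite (le_trans (ler_wpM2r (sqrtr_ge0 _) (ler_norm M))) //.
by rewrite ler_piMr.
Qed.

End OperatorNorm.

Section HilbertNorm.
Context (R : realType) (A : cstarAlgType R) (V : hilbertModType A).

Lemma rnorm_inner (x : V) : rnorm (inner x x : A) = rnorm x ^+ 2.
Proof. by apply: (@complexI R); rewrite rmorphXn /= !rnormE norm_inner. Qed.

Lemma hnormE (x : V) : hnorm x = rnorm x.
Proof. by rewrite /hnorm -/(rnorm _) rnorm_inner sqrtr_sqr ger0_norm ?rnorm_ge0. Qed.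

End HilbertNorm.

(** * Unitization *)

Definition unitization (R : realType) (A : cstarAlgType R) := (R[i] * A)%type.

HB.instance Definition _ (R : realType) (A : cstarAlgType R) :=
  GRing.Zmodule.copy (unitization A) (R[i] * A)%type.

Section Unitization.
Context (R : realType) (A : cstarAlgType R).
Implicit Types (u v w : unitization A) (a b c : A) (t : R).

Definition umul u v : unitization A :=
  (u.1 * v.1, u.1 *: v.2 + v.1 *: u.2 + cmul u.2 v.2).
Definition uscale t u : unitization A := (t%:C * u.1, t%:C *: u.2).

Lemma umulA : associative umul.
Proof.
case=> k a [l b] [m c]; congr pair => /=; first exact: mulrA.
rewrite !cmulDl !cmulDr !cmulZl !cmulZr cmulA.
lmod R[i] A.
Qed.

Lemma umul1l : left_id (1, 0) umul.
Proof. by case=> k a; rewrite /umul /= cmul0l mul1r; congr pair; lmod R[i] A. Qed.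

Lemma umul1r : right_id (1, 0) umul.
Proof. by case=> k a; rewrite /umul /= cmul0r mulr1; congr pair; lmod R[i] A. Qed.

Lemma umulDl : left_distributive umul +%R.
Proof.
case=> k a [l b] [m c]; congr pair => /=; first exact: mulrDl.
by rewrite cmulDl; lmod R[i] A.
Qed.

Lemma umulDr : right_distributive umul +%R.
Proof.
case=> k a [l b] [m c]; congr pair => /=; first exact: mulrDr.
by rewrite cmulDr; lmod R[i] A.
Qed.

Fact uone_neq0 : ((1, 0) : unitization A) != 0.
Proof. by rewrite xpair_eqE oner_eq0. Qed.

HB.instance Definition _ := GRing.Zmodule_isNzRing.Build (unitization A)
  umulA umul1l umul1r umulDl umulDr uone_neq0.

Fact uscaleA t s u : uscale t (uscale s u) = uscale (t * s) u.
Proof. by rewrite /uscale /= rmorphM mulrA scalerA. Qed.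

Fact uscale1 : left_id 1 uscale.
Proof. by case=> k a; rewrite /uscale /= mul1r scale1r. Qed.

Fact uscaleDr : right_distributive uscale +%R.
Proof. by move=> t u v; rewrite /uscale /= mulrDr scalerDr. Qed.

Fact uscaleDl u : {morph uscale^~ u : s t / s + t}.
Proof. by move=> s t; rewrite /uscale rmorphD /= mulrDl scalerDl. Qed.

HB.instance Definition _ := GRing.Zmodule_isLmodule.Build R (unitization A)
  uscaleA uscale1 uscaleDr uscaleDl.

Fact uscaleAl t u v : t *: (u * v) = (t *: u) * v.
Proof.
congr pair; rewrite /= ?mulrA //.
by rewrite cmulZl; lmod R[i] A.
Qed.

HB.instance Definition _ :=
  GRing.Lmodule_isLalgebra.Build R (unitization A) uscaleAl.

Fact uscaleAr t u v : t *: (u * v) = u * (t *: v).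
Proof.
congr pair; rewrite /= ?mulrA; first by rewrite (mulrC u.1).
by rewrite cmulZr; lmod R[i] A.
Qed.

HB.instance Definition _ :=
  GRing.Lalgebra_isAlgebra.Build R (unitization A) uscaleAr.

Definition ustar u : unitization A := (conjc u.1, cstar u.2).
Definition uact u : A -> A := fun b => u.1 *: b + cmul u.2 b.
Definition unorm u : R := opnorm (uact u).
Definition emb a : unitization A := (0, a).
Definition uii : unitization A := ('i, 0).

Lemma uactM u v b : uact (u * v) b = uact u (uact v b).
Proof.
case: u v => k a [l c]; rewrite /uact /=.
rewrite !cmulDl !cmulDr !cmulZl !cmulZr cmulA.
lmod R[i] A.
Qed.

Lemma uactD u v b : uact (u + v) b = uact u b + uact v b.
Proof. by case: u v => k a [l c]; rewrite /uact /= cmulDl; lmod R[i] A. Qed.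

Lemma uactZ t u b : uact (t *: u) b = t%:C *: uact u b.
Proof. by case: u => k a; rewrite /uact /= cmulZl; lmod R[i] A. Qed.

Lemma uact_scale u (k : R[i]) b : uact u (k *: b) = k *: uact u b.
Proof. by case: u => l a; rewrite /uact /= cmulZr; lmod R[i] A. Qed.

Lemma uact_star u b c :
  cmul (cstar (uact u b)) c = cmul (cstar b) (uact (ustar u) c).
Proof.
case: u => k a; rewrite /uact /= cstarD cstarZ cstarM.
by rewrite cmulDl cmulDr !cmulZl !cmulZr cmulA.
Qed.

Lemma rnorm_uact_bound u b : rnorm (uact u b) <= (cmod u.1 + rnorm u.2) * rnorm b.
Proof.
by rewrite mulrDl (le_trans (rnormD _ _)) // rnormZ lerD // rnormM.
Qed.

Lemma rnorm_uact u b : rnorm (uact u b) <= unorm u * rnorm b.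
Proof.
have := @le_opnorm R A A A (uact u) (cmod u.1 + rnorm u.2).
rewrite -!hnormE; apply.
- by move=> t z; rewrite !hnormE rnormZ cmod_real.
- by move=> t z; rewrite uact_scale !hnormE rnormZ cmod_real.
- by move=> z; rewrite !hnormE rnorm_uact_bound.
Qed.

Lemma unorm_le u M : 0 <= M -> (forall b, rnorm (uact u b) <= M * rnorm b) ->
  unorm u <= M.
Proof. by move=> M0 uM; apply: opnorm_le => // z; rewrite !hnormE; exact: uM. Qed.

Lemma unorm_ge0 u : 0 <= unorm u.
Proof.
apply: (@opnorm_ge0 _ _ _ _ _ (cmod u.1 + rnorm u.2)) => z.
by rewrite !hnormE rnorm_uact_bound.
Qed.

Lemma unorm_emb a : unorm (emb a) = rnorm a.
Proof.
have actE b : uact (emb a) b = cmul a b by rewrite /uact /= scale0r add0r.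
apply/le_anti/andP; split.
  by apply: unorm_le => [|b]; [exact: rnorm_ge0|rewrite actE rnormM].
have [->|a0] := eqVneq (rnorm a) 0; first exact: unorm_ge0.
have a1 : 0 < rnorm a by rewrite lt_def a0 rnorm_ge0.
rewrite -(ler_pM2r a1) -expr2 -{1}(rnorm_star a) -rnorm_starM cstarK.
by rewrite -actE (le_trans (rnorm_uact _ _)) // rnorm_star.
Qed.

Lemma cstar_seminorm_unitization : cstar_seminorm ustar uii unorm.
Proof.
split.
- by case=> k a; rewrite /ustar /= conjcK cstarK.
- by case=> k a [l b]; rewrite /ustar /= rmorphD cstarD.
- case=> k a [l b]; congr pair; first by rewrite mulrC; exact: rmorphM.
  by rewrite /= !cstarD !cstarZ cstarM; lmod R[i] A.
- move=> t [k a]; have tJ := conjc_real t.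
  congr pair; first exact: etrans (rmorphM _ _ _) (congr1 (fun z => z * _) tJ).
  exact: etrans (cstarZ _ _) (congr1 (fun z => z *: _) tJ).
- case=> k a; congr pair; first exact: mulrC.
  by rewrite /= cmul0l cmul0r; lmod R[i] A.
- congr pair; rewrite /= ?cmul0l ?scaler0 ?addr0 ?oppr0 //.
  by rewrite -expr2 sqr_i.
- congr pair; last by rewrite /= cstar0 oppr0.
  by apply/eqP; rewrite eq_complex /= oppr0 !eqxx.
- move=> u v; apply: unorm_le => [|b]; first by rewrite addr_ge0 ?unorm_ge0.
  by rewrite uactD mulrDl (le_trans (rnormD _ _)) // lerD ?rnorm_uact.
- move=> t u; apply: unorm_le => [|b]; first by rewrite mulr_ge0 ?unorm_ge0.
  by rewrite uactZ rnormZ cmod_real -mulrA ler_wpM2l ?rnorm_uact.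
- move=> u v; apply: unorm_le => [|b]; first by rewrite mulr_ge0 ?unorm_ge0.
  rewrite uactM (le_trans (rnorm_uact _ _)) // -mulrA.
  by rewrite ler_wpM2l ?unorm_ge0 ?rnorm_uact.
(* The squared norm of [u b] is the norm of [b^* (u^* u b)], at most [unorm (u^* u)] times the
   squared norm of [b]. *)
- move=> u; have U0 := unorm_ge0 (ustar u * u).
  rewrite -(sqr_sqrtr U0) ler_pXn2r ?nnegrE ?unorm_ge0 ?sqrtr_ge0 //.
  apply: unorm_le => [|b]; first exact: sqrtr_ge0.
  rewrite -(@ler_pXn2r _ 2) ?nnegrE ?rnorm_ge0 ?mulr_ge0 ?sqrtr_ge0 ?rnorm_ge0 //.
  rewrite exprMn sqr_sqrtr // -rnorm_starM uact_star -uactM.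
  apply: le_trans (rnormM _ _) _; rewrite rnorm_star.
  by have := rnorm_uact (ustar u * u) b; have := rnorm_ge0 b; nra.
Qed.

End Unitization.

(** * Positive functionals *)

Section HahnBanach.
Context (R : realType) (V : lmodType R).
Implicit Types (p q : V -> R) (x y z : V) (t : R).

Definition sublinear q :=
  (forall x y, q (x + y) <= q x + q y) /\
  (forall t x, 0 <= t -> q (t *: x) <= t * q x).

Lemma sublinear0 q : sublinear q -> q 0 = 0.
Proof.
move=> [qD qZ]; apply/le_anti/andP; split.
  by have := qZ 0 0 (lexx 0); rewrite scaler0 mul0r.
by have := qD 0 0; rewrite addr0 -[X in X <= _]addr0 lerD2l.
Qed.

Lemma sublinearN q x : sublinear q -> - q (- x) <= q x.
Proof.
move=> sq; have [qD _] := sq; have := qD x (- x).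
by rewrite subrr sublinear0 // lerNl -lerBlDl sub0r lerNl.
Qed.

(* The largest sublinear functional below [q] that is additive in the
   direction [y]. *)
Definition sublinear_shift q y x : R :=
  inf [set q (x + t *: y) - t * q y | t in [set t | 0 <= t]].

Section Shift.
Context (q : V -> R) (y : V) (sq : sublinear q).

Lemma sublinear_shift_le x t : 0 <= t ->
  sublinear_shift q y x <= q (x + t *: y) - t * q y.
Proof.
move=> t0; have [qD qZ] := sq; apply: ge_inf; last by exists t.
exists (- q (- x)) => _ [s /= s0 <-].
have := qD (x + s *: y) (- x); rewrite addrAC subrr add0r.
have := qD (s *: y) (- (s *: y)); have := sublinearN (s *: y) sq.
have := qZ s^-1 (s *: y); rewrite invr_ge0 => /(_ s0).
have [->|s1] := eqVneq s 0; first by rewrite scale0r sublinear0 //; lra.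
rewrite scalerK // ler_pdivlMl ?lt_def ?s1 //; lra.
Qed.

Lemma le_sublinear_shift x m :
  (forall t, 0 <= t -> m <= q (x + t *: y) - t * q y) ->
  m <= sublinear_shift q y x.
Proof.
move=> H; apply: lb_le_inf; first by exists (q (x + 0 *: y) - 0 * q y); exists 0 => /=.
by move=> _ [t /= t0 <-]; exact: H.
Qed.

Lemma sublinear_shiftP : sublinear (sublinear_shift q y).
Proof.
have [qD qZ] := sq; split=> [x z|c x].
  rewrite -lerBlDr; apply: le_sublinear_shift => t t0.
  rewrite lerBlDr -lerBlDl; apply: le_sublinear_shift => s s0.
  rewrite lerBlDl.
  apply: le_trans (sublinear_shift_le _ (addr_ge0 t0 s0)) _.
  have := qD (x + t *: y) (z + s *: y).
  by rewrite addrACA -scalerDl mulrDl; lra.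
rewrite le_eqVlt => /predU1P[<-|c0].
  rewrite mul0r scale0r; apply: le_trans (sublinear_shift_le _ (lexx 0)) _.
  by rewrite scale0r addr0 mul0r subr0 sublinear0.
rewrite mulrC -ler_pdivrMr //; apply: le_sublinear_shift => t t0.
rewrite ler_pdivrMr //.
apply: le_trans (sublinear_shift_le _ (mulr_ge0 (ltW c0) t0)) _.
by have := qZ c (x + t *: y) (ltW c0); rewrite scalerDr scalerA; lra.
Qed.

End Shift.

(** Zorn's lemma with pointwise infima of chains. These are finite since a sublinear [s] below [p]
    satisfies [- p (- x) <= s x], and subadditive since two members of a chain can be replaced by
    the smaller one. *)
Lemma minimal_sublinear p : sublinear p ->
  exists2 q, sublinear q /\ (forall x, q x <= p x)
    & forall r, sublinear r -> (forall x, r x <= q x) -> forall x, q x <= r x.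
Proof.
move=> sp; pose T := {q | sublinear q /\ forall x, q x <= p x}.
pose le (s t : T) := `[< forall x, sval t x <= sval s x >].
have t0 : T by exists p.
have [|r s t /asboolP rs /asboolP st||t tm] := @ZL_preorder T t0 le.
- by move=> t; apply/asboolP => x.
- by apply/asboolP => x; exact: le_trans (st x) (rs x).
- move=> S totS; have [S0|/set0P[s0 Ss0]] := eqVneq S set0.
    by exists t0 => s; rewrite S0.
  pose q x := inf [set sval s x | s in S].
  have inf_le_at s x : S s -> q x <= sval s x.
    move=> Ss; apply: ge_inf; last by exists s.
    exists (- p (- x)) => _ [t _ <-]; have [st tp] := svalP t.
    by rewrite (le_trans _ (sublinearN x st)) // lerN2.
  have infP m x : (forall s, S s -> m <= sval s x) -> m <= q x.
    move=> H; apply: lb_le_inf; first by exists (sval s0 x); exists s0.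
    by move=> _ [s Ss <-]; exact: H.
  have sq : sublinear q /\ forall x, q x <= p x.
    split; last first.
      by move=> x; apply: le_trans (inf_le_at _ x Ss0) _; case: (svalP s0).
    split=> [x y|t x t0'].
      rewrite -lerBlDr; apply: (infP) => s Ss; rewrite lerBlDr -lerBlDl.
      apply: (infP) => t St; rewrite lerBlDl.
      have [/asboolP st|/asboolP ts] := totS s t Ss St.
        apply: le_trans (inf_le_at _ _ St) _; have [[tD _] _] := svalP t.
        by rewrite (le_trans (tD _ _)) // lerD.
      apply: le_trans (inf_le_at _ _ Ss) _; have [[sD _] _] := svalP s.
      by rewrite (le_trans (sD _ _)) // lerD.
    move: t0'; rewrite le_eqVlt => /predU1P[<-|t1].
      rewrite mul0r scale0r; apply: le_trans (inf_le_at _ _ Ss0) _.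
      by have [ss _] := svalP s0; rewrite sublinear0.
    rewrite mulrC -ler_pdivrMr //; apply: (infP) => s Ss; rewrite ler_pdivrMr //.
    apply: le_trans (inf_le_at _ _ Ss) _; have [[_ sZ] _] := svalP s.
    by rewrite mulrC sZ // ltW.
  by exists (exist _ q sq) => s Ss; apply/asboolP => x /=; exact: inf_le_at.
have [st tp] := svalP t; exists (sval t) => // r sr rt x.
have sr' : sublinear r /\ forall x, r x <= p x.
  by split=> // z; exact: le_trans (rt z) (tp z).
have := tm (exist _ r sr'); rewrite /le /= => /(_ _)/asboolP; apply.
exact/asboolP.
Qed.

(* A minimal sublinear functional is linear. *)
Theorem hahn_banach p h : sublinear p ->
  exists f : V -> R, [/\ forall x y, f (x + y) = f x + f y,
    forall t x, f (t *: x) = t * f x, forall x, f x <= p x & f h = p h].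
Proof.
(* Minimizing below the shift along [h], not merely below [p], forces [f h = p h]: the shift at
   [- h], taken with [t = 1], is at most [- p h]. *)
move=> sp; have ss := sublinear_shiftP h sp.
have [f [sf fs] fmin] := minimal_sublinear ss.
have fp x : f x <= p x.
  apply: le_trans (fs x) _; have := sublinear_shift_le h sp x (lexx 0).
  by rewrite scale0r addr0 mul0r subr0.
have fD x y : f (x + y) = f x + f y.
  have [fD _] := sf; apply/le_anti; rewrite fD /=.
  (* By minimality [f] is at most its own shift along [y], and the shift at [x] with [t = 1] is at
     most [f (x + y) - f y]. *)
  rewrite -lerBrDr; apply: le_trans (_ : sublinear_shift f y x <= _).
    apply: fmin; first exact: sublinear_shiftP.
    move=> z; have := sublinear_shift_le y sf z (lexx 0).
    by rewrite scale0r addr0 mul0r subr0.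
  by have := sublinear_shift_le y sf x ler01; rewrite scale1r mul1r.
have fN x : f (- x) = - f x.
  by apply/eqP; rewrite -addr_eq0 -fD addNr sublinear0.
have fZ t x : 0 <= t -> f (t *: x) = t * f x.
  move=> t0; have [_ fZ] := sf; apply/le_anti; rewrite fZ //=.
  by rewrite -lerN2 -mulrN -!fN -scalerN fZ.
exists f; split=> // [t x|].
  have [/fZ//|t0] := leP 0 t.
  by rewrite -[t]opprK scaleNr fN fZ ?mulNr // oppr_ge0 ltW.
apply/le_anti; rewrite fp /= -lerN2 -fN (le_trans (fs _)) //.
have := sublinear_shift_le h sp (- h) ler01.
by rewrite scale1r addNr mul1r sublinear0 // sub0r.
Qed.

End HahnBanach.

(** * Positive functionals that attain the norm of a positive element *)

Record positive_functional (R : realType) (A : cstarAlgType R)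
    (psi : A -> R[i]) : Prop := {
  pf_lin : forall k a b, psi (k *: a + b) = k * psi a + psi b;
  pf_star : forall a, psi (cstar a) = conjc (psi a);
  pf_pos : forall a, cpositive (@ustar R A) (@unorm R A) (emb a) -> 0 <= psi a;
  pf_norm : forall a, cmod (psi a) <= rnorm a
}.

Section PositiveElements.
Context (R : realType) (A : cstarAlgType R).
Implicit Types (a b c h : A) (t : R).

Let US := cstar_seminorm_unitization A.

Definition apos h := cpositive (@ustar R A) (@unorm R A) (emb h).

Lemma embD a b : emb (a + b) = emb a + emb b.
Proof. by congr pair; rewrite /= addr0. Qed.

Lemma embZ t a : emb (t%:C *: a) = t *: emb a.
Proof. by congr pair; rewrite /= mulr0. Qed.

Lemma embN a : emb (- a) = - emb a.
Proof. by congr pair; rewrite /= oppr0. Qed.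

Lemma embM a b : emb (cmul a b) = emb a * emb b.
Proof. by congr pair; rewrite /= ?mulr0 // !scale0r !add0r. Qed.

Lemma emb_star a : emb (cstar a) = ustar (emb a).
Proof. by rewrite /ustar /emb conjc0. Qed.

Lemma apos_selfadj h : apos h -> cstar h = h.
Proof. by case=> + _; rewrite /selfadj -emb_star => -[]. Qed.

Lemma aposD a b : apos a -> apos b -> apos (a + b).
Proof. by rewrite /apos embD; exact: (cpositiveD US). Qed.

Lemma apos_starM a : apos (cmul (cstar a) a).
Proof. by rewrite /apos embM emb_star; exact: (cpositive_starM US). Qed.

Lemma cpos_apos a : cpos a -> apos a.
Proof. by case=> b ->; exact: apos_starM. Qed.

Lemma apos_conj_sub h c : cstar h = h ->
  apos ((rnorm h)%:C *: cmul (cstar c) c - cmul (cmul (cstar c) h) c).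
Proof.
move=> sh; rewrite /apos embD embN embZ !embM emb_star.
have -> : rnorm h *: (ustar (emb c) * emb c) - ustar (emb c) * emb h * emb c =
    ustar (emb c) * ((rnorm h)%:A - emb h) * emb c.
  by rewrite mulrBr mulrBl -scalerAr mulr1 -scalerAl.
apply: (cpositive_conj US); apply: (cpositive_ball US).
  by rewrite /selfadj -emb_star sh.
by rewrite unorm_emb.
Qed.

Lemma rnorm_mono h k : apos h -> apos k -> rnorm h <= rnorm (h + k).
Proof.
by move=> ph pk; rewrite -!unorm_emb embD; exact: (snorm_mono US).
Qed.

(* The real functional is a Hahn-Banach extension dominated by the distance
   to the cone of negative elements. *)
Lemma exists_positive_functional h : apos h ->
  exists2 psi, positive_functional psi & psi h = (rnorm h)%:C.
Proof.
move=> ph; pose U := unitization A.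
pose pos := cpositive (@ustar R A) (@unorm R A).
pose p (u : U) : R := inf [set unorm (u + k) | k in pos].
have p_le u k : pos k -> p u <= unorm (u + k).
  move=> pk; apply: ge_inf; last by exists k.
  by exists 0 => _ [l _ <-]; exact: unorm_ge0.
have le_p u m : (forall k, pos k -> m <= unorm (u + k)) -> m <= p u.
  move=> H; apply: lb_le_inf; last by move=> _ [k pk <-]; exact: H.
  by exists (unorm (u + 0)); exists 0 => //; exact: (cpositive0 US).
have p0 : p 0 <= 0.
  by rewrite (le_trans (p_le _ _ (cpositive0 US))) // addr0 (snorm0 US).
have sp : sublinear p.
  split=> [u v|t u].
    rewrite -lerBlDr; apply: (le_p) => k pk; rewrite lerBlDr -lerBlDl.
    apply: (le_p) => l pl; rewrite lerBlDl.
    apply: le_trans (p_le _ _ (cpositiveD US pk pl)) _.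
    by rewrite addrACA (cs_normD US).
  rewrite le_eqVlt => /predU1P[<-|t0]; first by rewrite scale0r mul0r.
  rewrite mulrC -ler_pdivrMr //; apply: (le_p) => k pk; rewrite ler_pdivrMr //.
  apply: le_trans (p_le _ _ (cpositiveZ US (ltW t0) pk)) _.
  by rewrite -scalerDr (snormZ US) ger0_norm ?(ltW t0) // mulrC.
have [f [fD fZ fp fh]] := hahn_banach (emb h) sp.
have f0N u : f u <= unorm u.
  apply: le_trans (fp u) _; have := p_le u 0 (cpositive0 US).
  by rewrite addr0.
have fpos u : pos u -> 0 <= f u.
  move=> pu; rewrite -oppr_le0 -mulN1r -fZ (le_trans (fp _)) //.
  have := p_le (-1 *: u) u pu; rewrite scaleN1r addNr => /le_trans; apply.
  by rewrite (snorm0 US).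
(* Adding a positive element does not decrease the norm of [h], so the distance from [h] to the
   negative cone is its norm. *)
have fhN : f (emb h) = rnorm h.
  apply/le_anti; rewrite -{1}unorm_emb f0N fh /=; apply: (le_p) => k pk.
  by rewrite -unorm_emb; exact: (snorm_mono US).
(* Averaging over the involution makes the complexification [psi] of [g] hermitian, without changing
   [f] on positive elements. *)
pose g a : R := 2^-1 * (f (emb a) + f (emb (cstar a))).
have gD a b : g (a + b) = g a + g b.
  by rewrite /g cstarD !embD !fD; ring.
have gZ t a : g (t%:C *: a) = t * g a.
  rewrite /g cstarZ [conjc _]conjc_real !embZ !fZ; ring.
have gN a : g (- a) = - g a.
  have := gZ (-1) a; rewrite rmorphN rmorph1 scaleN1r => ->.
  by rewrite mulN1r.
have gstar a : g (cstar a) = g a by rewrite /g cstarK addrC.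
have g_norm a : g a <= rnorm a.
  have := f0N (emb a); have := f0N (emb (cstar a)).
  rewrite !unorm_emb rnorm_star /g => h1 h2; lra.
pose psi a : R[i] := g a +i* - g ('i *: a).
have psiD a b : psi (a + b) = psi a + psi b.
  by rewrite /psi scalerDr !gD opprD.
have psiZ t a : psi (t%:C *: a) = t%:C * psi a.
  rewrite /psi scalerA mulrC -scalerA !gZ.
  by apply/eqP; rewrite eq_complex /=; apply/andP; split; apply/eqP; ring.
have psii a : psi ('i *: a) = 'i * psi a.
  rewrite /psi scalerA -expr2 sqr_i scaleN1r gN opprK.
  by apply/eqP; rewrite eq_complex /=; apply/andP; split; apply/eqP; ring.
have psiM k a : psi (k *: a) = k * psi a.
  rewrite [k]complexE scalerDl psiD psiZ -scalerA psii psiZ mulrDl.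
  by rewrite mulrA.
have gi a : apos a -> g ('i *: a) = 0.
  move=> pa; have E : cstar ('i *: a) = - ('i *: a).
    rewrite cstarZ (apos_selfadj pa) -scaleNr; congr (_ *: _).
    by apply/eqP; rewrite eq_complex /= oppr0 !eqxx.
  have := gstar ('i *: a); rewrite E gN => Eg; lra.
exists psi.
  split.
  - by move=> k a b; rewrite psiD psiM.
  - move=> a; have -> : conjc (psi a) = g a +i* g ('i *: a).
      by rewrite /psi /= opprK.
    rewrite /psi gstar; congr (_ +i* _).
    rewrite -(gstar ('i *: a)) cstarZ -gN -scaleNr; congr (g (_ *: _)).
    by apply/eqP; rewrite eq_complex /= oppr0 !eqxx.
  - move=> a pa; have sa : cstar a = a by exact: apos_selfadj.
    rewrite /psi gi // oppr0 ler0c /g sa.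
    have := fpos (emb a) pa; lra.
  move=> a; have [w w1 wE] := exists_phase (psi a).
  move: wE; rewrite -psiM => -[<- _]; apply: le_trans (g_norm _) _.
  by rewrite rnormZ w1 mul1r.
rewrite /psi gi // oppr0; congr (_ +i* _); rewrite /g apos_selfadj // fhN; lra.
Qed.

End PositiveElements.

(** * Hilbert modules *)

(* The part of the Hilbert module axioms that the direct sum [A * V], whose
   library norm is not the Hilbert module norm, satisfies as well. *)
Record semi_inner (R : realType) (A : cstarAlgType R) (E : innerModType A) :
    Prop := {
  si_Dr : forall x y z : E, inner x (y + z) = inner x y + inner x z :> A;
  si_Zr : forall k (x y : E), inner x (k *: y) = k *: inner x y :> A;
  si_star : forall x y : E, cstar (inner x y) = inner y x :> A;
  si_pos : forall x : E, apos (inner x x : A)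
}.

Section SemiInner.
Context (R : realType) (A : cstarAlgType R) (E : innerModType A).
Context (SI : semi_inner E).
Implicit Types (x y z : E) (k : R[i]).

Lemma si_Dl x y z : inner (x + y) z = inner x z + inner y z :> A.
Proof. by rewrite -(si_star SI) (si_Dr SI) cstarD !(si_star SI). Qed.

Lemma si_Zl k x y : inner (k *: x) y = conjc k *: inner x y :> A.
Proof. by rewrite -(si_star SI) (si_Zr SI) cstarZ (si_star SI). Qed.

Lemma hnorm_ge0 x : 0 <= hnorm x.
Proof. exact: sqrtr_ge0. Qed.

Lemma hnorm_sqr x : hnorm x ^+ 2 = rnorm (inner x x : A).
Proof. by rewrite sqr_sqrtr // rnorm_ge0. Qed.

Lemma hnormZ k x : hnorm (k *: x) = cmod k * hnorm x.
Proof.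
apply/eqP; rewrite -(@eqrXn2 _ 2) ?hnorm_ge0 ?mulr_ge0 ?cmod_ge0 ?hnorm_ge0 //.
rewrite exprMn !hnorm_sqr (si_Zr SI) si_Zl scalerA rnormZ cmodM cmodJ.
by rewrite expr2.
Qed.

Context (psi : A -> R[i]) (pf : positive_functional psi).

Lemma pfD a b : psi (a + b) = psi a + psi b.
Proof. by rewrite -[a]scale1r (pf_lin pf) mul1r scale1r. Qed.

Lemma pf0 : psi 0 = 0.
Proof. by apply: (addrI (psi 0)); rewrite -pfD !addr0. Qed.

Lemma pfZ k a : psi (k *: a) = k * psi a.
Proof. by rewrite -[k *: a]addr0 (pf_lin pf) pf0 addr0. Qed.

Lemma pfN a : psi (- a) = - psi a.
Proof. by rewrite -scaleN1r pfZ mulN1r. Qed.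

Lemma pf_apos a : apos a -> psi a = (complex.Re (psi a))%:C.
Proof. by move=> pa; rewrite RRe_real // ger0_real // (pf_pos pf). Qed.

Lemma pf_Re_ge0 a : apos a -> 0 <= complex.Re (psi a).
Proof. by move=> pa; rewrite -ler0c -pf_apos // (pf_pos pf). Qed.

Lemma pf_Re_le a : complex.Re (psi a) <= rnorm a.
Proof.
apply: le_trans (pf_norm pf a); rewrite -lecR cmodE.
by apply: le_trans (normc_ge_Re _); rewrite lecR ler_norm.
Qed.

Lemma pf_Re_inner_le x : complex.Re (psi (inner x x)) <= hnorm x ^+ 2.
Proof. by rewrite hnorm_sqr pf_Re_le. Qed.

(* Positivity of the form at [x - r <y, x> y] for real [r]. *)
Lemma pf_cauchy_schwarz x y : cmod (psi (inner x y)) ^+ 2 <=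
  complex.Re (psi (inner x x)) * complex.Re (psi (inner y y)).
Proof.
have px := pf_Re_ge0 (si_pos SI x); have py := pf_Re_ge0 (si_pos SI y).
set p := complex.Re _ in px *; set q := complex.Re _ in py *.
set s := psi (inner x y); set n := cmod s ^+ 2.
have sE : s * conjc s = n%:C by rewrite -sqr_normc rmorphXn /= cmodE.
have quad (r : R) : 0 <= p - 2 * r * n + r ^+ 2 * n * q.
  pose l := - (r%:C * conjc s); pose z := x + l *: y.
  rewrite -ler0c; apply: le_trans (pf_pos pf (si_pos SI z)) _.
  rewrite si_Dl !(si_Dr SI) !si_Zl !(si_Zr SI) !pfD !pfZ.
  rewrite -(si_star SI x y) (pf_star pf) -/s.
  rewrite (pf_apos (si_pos SI x)) (pf_apos (si_pos SI y)) -/p -/q.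
  have -> : conjc l = - (r%:C * s).
    by rewrite /l rmorphN rmorphM /= conjcK; congr (- (_ * _)); exact: conjc_real.
  have -> : (p - 2 * r * n + r ^+ 2 * n * q)%:C =
      p%:C - 2 * r%:C * (s * conjc s) + r%:C ^+ 2 * (s * conjc s) * q%:C.
    by rewrite sE !(rmorphD, rmorphN, rmorphM, rmorphXn, rmorph_nat).
  by rewrite /l le_eqVlt; apply/orP; left; apply/eqP; ring.
(* For [q = 0] the quadratic is affine in [r] and negative at [(p + 1) / n] unless [n = 0];
   otherwise its minimum, at [r = q^-1], is the claim. *)
have [q0|q0] := eqVneq q 0.
  rewrite q0 mulr0 leNgt; apply/negP => n0.
  have := quad ((p + 1) / n); rewrite q0 mulr0 addr0.
  have -> : 2 * ((p + 1) / n) * n = 2 * (p + 1) by field; rewrite gt_eqF.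
  by lra.
have q1 : 0 < q by rewrite lt_def q0.
have := quad q^-1; have -> : p - 2 * q^-1 * n + q^-1 ^+ 2 * n * q = p - n / q by field.
by rewrite subr_ge0 ler_pdivrMr.
Qed.

End SemiInner.

Section HilbertModule.
Context (R : realType) (A : cstarAlgType R) (V : hilbertModType A).
Implicit Types (x y z : V) (a c : A) (k : R[i]).

Lemma hilbert_semi_inner : semi_inner V.
Proof.
split; [exact: innerDr|exact: innerZr|exact: inner_star|].
by move=> x; apply: cpos_apos; exact: inner_pos.
Qed.

Let SI := hilbert_semi_inner.

Lemma inner_ractl x y a : inner (ract x a) y = cmul (cstar a) (inner x y) :> A.
Proof. by rewrite -inner_star inner_ract cstarM inner_star. Qed.

Lemma ract0r x : ract x 0 = 0.
Proof. by rewrite -(scale0r (0 : A)) ractZr !scale0r. Qed.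

Lemma ract0l a : ract (0 : V) a = 0.
Proof. by rewrite -(scale0r (0 : V)) ractZl !scale0r. Qed.

Lemma inner0r x : inner x (0 : V) = 0 :> A.
Proof. by rewrite -(scale0r (0 : V)) innerZr !scale0r. Qed.

Lemma inner0l x : inner (0 : V) x = 0 :> A.
Proof. by rewrite -inner_star inner0r cstar0. Qed.

Lemma innerNr x y : inner x (- y) = - inner x y :> A.
Proof. by rewrite -scaleN1r innerZr scaleN1r. Qed.

Lemma rnorm_ract x a : rnorm (ract x a) <= rnorm x * rnorm a.
Proof.
rewrite -(@ler_pXn2r _ 2) ?nnegrE ?mulr_ge0 ?rnorm_ge0 //.
rewrite -rnorm_inner inner_ract inner_ractl exprMn -rnorm_inner.
apply: le_trans (rnormM _ _) _.
have := rnormM (cstar a) (inner x x); rewrite rnorm_star.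
by have := rnorm_ge0 a; nra.
Qed.

Section Functional.
Context (psi : A -> R[i]) (pf : positive_functional psi).

Lemma pf_conj_le h c : cstar h = h ->
  complex.Re (psi (cmul (cmul (cstar c) h) c)) <=
  rnorm h * complex.Re (psi (cmul (cstar c) c)).
Proof.
move=> sh; have := pf_Re_ge0 pf (apos_conj_sub c sh).
rewrite (pfD pf) (pfN pf) (pfZ pf) raddfB /=.
by rewrite (pf_apos pf (apos_starM c)) -rmorphM /= subr_ge0.
Qed.

Lemma pf_ract_le x a : complex.Re (psi (inner (ract x a) (ract x a))) <=
  rnorm x ^+ 2 * complex.Re (psi (cmul (cstar a) a)).
Proof.
rewrite inner_ract inner_ractl -rnorm_inner; apply: pf_conj_le.
exact: inner_star.
Qed.

(** Cauchy-Schwarz at [y] and [x <x, y>] bounds the square of the left side [G] by [psi <y, y>]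
    times a quantity at most [rnorm x ^+ 2 * G]; one factor [G] cancels. *)
Lemma pf_inner_le x y :
  complex.Re (psi (cmul (cstar (inner x y)) (inner x y))) <=
  rnorm x ^+ 2 * complex.Re (psi (inner y y)).
Proof.
have E : inner y (ract x (inner x y)) = cmul (cstar (inner x y)) (inner x y) :> A.
  by rewrite inner_ract inner_star.
have := pf_cauchy_schwarz SI pf y (ract x (inner x y)).
rewrite E {1}(pf_apos pf (apos_starM _)) cmod_real.
have := pf_ract_le x (inner x y).
have := pf_Re_ge0 pf (apos_starM (inner x y)).
have := pf_Re_ge0 pf (si_pos SI y).
have := pf_Re_ge0 pf (si_pos SI (ract x (inner x y))).
move: (complex.Re (psi (inner (ract x _) _))) => P.
move: (complex.Re (psi (cmul (cstar _) _))) => G.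
move: (complex.Re (psi (inner y y))) => Q P0 Q0 G0 PG.
rewrite ger0_norm // expr2 => GQP.
have GQ : G * G <= Q * (rnorm x ^+ 2 * G) by rewrite (le_trans GQP) // ler_wpM2l.
have [->|G1] := eqVneq G 0; first by rewrite mulr_ge0 // sqr_ge0.
have G2 : 0 < G by rewrite lt_def G1.
by rewrite -(ler_pM2r G2) (le_trans GQ) // mulrCA mulrA.
Qed.

End Functional.

Lemma rnorm_inner_le x y : rnorm (inner x y : A) <= rnorm x * rnorm y.
Proof.
rewrite -(@ler_pXn2r _ 2) ?nnegrE ?mulr_ge0 ?rnorm_ge0 // -rnorm_starM.
have [psi pf E] := exists_positive_functional (apos_starM (inner x y)).
apply: le_trans (_ : complex.Re (psi (cmul (cstar (inner x y)) (inner x y))) <= _).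
  by rewrite E.
rewrite (le_trans (pf_inner_le pf x y)) // exprMn ler_wpM2l ?sqr_ge0 //.
by rewrite -(rnorm_inner y) pf_Re_le.
Qed.

End HilbertModule.

(** * The direct sum [A (+) V] *)

Section DirectSum.
Context (R : realType) (A : cstarAlgType R) (V : hilbertModType A).
Implicit Types (z w : A * V).

Lemma inner_pair z w :
  inner z w = inner z.1 w.1 + inner z.2 w.2 :> A.
Proof. by []. Qed.

Lemma pair_semi_inner : semi_inner (A * V)%type.
Proof.
have SA := hilbert_semi_inner A; have SV := hilbert_semi_inner V.
split=> [x y z|k x y|x y|x]; rewrite !inner_pair.
- by rewrite (si_Dr SA) (si_Dr SV) addrACA.
- by rewrite (si_Zr SA) (si_Zr SV) scalerDr.
- by rewrite cstarD (si_star SA) (si_star SV).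
- by apply: aposD; [exact: (si_pos SA)|exact: (si_pos SV)].
Qed.

Let SI := pair_semi_inner.

Lemma hnorm_fst z : rnorm z.1 <= hnorm z.
Proof.
rewrite -(@ler_pXn2r _ 2) ?nnegrE ?rnorm_ge0 ?hnorm_ge0 //.
rewrite hnorm_sqr -rnorm_inner inner_pair.
by apply: rnorm_mono; exact: (si_pos (hilbert_semi_inner _)).
Qed.

Lemma hnorm_snd z : rnorm z.2 <= hnorm z.
Proof.
rewrite -(@ler_pXn2r _ 2) ?nnegrE ?rnorm_ge0 ?hnorm_ge0 //.
rewrite hnorm_sqr -rnorm_inner inner_pair addrC.
by apply: rnorm_mono; exact: (si_pos (hilbert_semi_inner _)).
Qed.

(* A positive functional that attains the norm at [<z, z>] reduces norm
   inequalities to scalar ones. *)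
Lemma hnorm_le_pf z w M : 0 <= M ->
  (forall psi, positive_functional psi ->
     complex.Re (psi (inner z z)) <= M ^+ 2 * complex.Re (psi (inner w w))) ->
  hnorm z <= M * hnorm w.
Proof.
move=> M0 zw; have [psi pf E] := exists_positive_functional (si_pos SI z).
rewrite -(@ler_pXn2r _ 2) ?nnegrE ?mulr_ge0 ?hnorm_ge0 //.
rewrite exprMn hnorm_sqr.
apply: le_trans (_ : complex.Re (psi (inner z z)) <= _); first by rewrite E.
rewrite (le_trans (zw psi pf)) // ler_wpM2l ?sqr_ge0 //.
exact: (pf_Re_inner_le pf).
Qed.

End DirectSum.

(** * Adjointable maps are bounded *)

Lemma rnorm_cauchy_limit (R : realType) (V : completeNormedModType R[i])
    (u : nat -> V) (r : nat -> R) :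
  (forall n m, (n <= m)%N -> rnorm (u m - u n) <= r n) ->
  (forall e, 0 < e -> exists n, r n < e) ->
  exists x, forall n, rnorm (x - u n) <= r n.
Proof.
move=> ur r0.
have /cauchy_cvg : cauchy (u @ \oo).
  apply: cauchy_exP => e e0.
  have eE : e = (complex.Re e)%:C by rewrite RRe_real // gtr0_real.
  have [|n rn] := r0 (complex.Re e); first by rewrite -ltcR -eE.
  exists (u n); exists n => //= m /= nm.
  rewrite -ball_normE /= -normrN opprB -rnormE eE ltcR.
  by rewrite (le_lt_trans (ur _ _ nm)).
move=> /cvg_ex[x ux]; exists x => n; apply/ler_addgt0Pr => e e0.
move/cvgrPdist_lt : ux => /(_ e%:C); rewrite ltcR => /(_ e0)[N _ /= uN].
have := uN (maxn n N) (leq_maxr _ _); rewrite -rnormE ltcR => xu.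
rewrite -[x - u n](subrKA (u (maxn n N))) addrC.
apply: le_trans (rnormD _ _) _; apply: lerD; last exact: ltW.
exact: ur (leq_maxl _ _).
Qed.

Section AdjointableBounded.
Context (R : realType) (A : cstarAlgType R) (V W : hilbertModType A).
Context (T : V -> W) (S : W -> V) (TS : adjoint T S).

Lemma adjoint_scale (k : R[i]) z : T (k *: z) = k *: T z.
Proof.
have SV := hilbert_semi_inner V; have SW := hilbert_semi_inner W.
apply/eqP; rewrite -subr_eq0; apply/eqP.
have H w : inner (T (k *: z) - k *: T z) w = 0 :> A.
  rewrite -scaleNr (si_Dl SW) (si_Zl SW) !TS (si_Zl SV) rmorphN /=.
  by rewrite scaleNr subrr.
exact/inner_eq0/H.
Qed.

(* Gliding hump. *)
Lemma adjoint_bounded : exists M, forall z, rnorm (T z) <= M * rnorm z.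
Proof.
apply: contrapT => unb.
have big n : exists v, rnorm v <= 1 /\ 4 ^+ n < rnorm (T v).
  apply: contrapT => small; apply: unb; exists (4 ^+ n) => z.
  have [z0|z0] := eqVneq (rnorm z) 0.
    rewrite (rnorm_eq0 z0) -(scale0r 0) adjoint_scale !scale0r !rnorm0.
    by rewrite mulr0.
  have z1 : 0 < rnorm z by rewrite lt_def z0 rnorm_ge0.
  rewrite leNgt; apply/negP => Tz; apply: small.
  exists ((rnorm z)^-1%:C *: z); rewrite adjoint_scale !rnormZ !cmod_real.
  rewrite ger0_norm ?invr_ge0 ?(ltW z1) // mulVf //; split=> //.
  by rewrite mulrC ltr_pdivlMr.
have [v vP] := choice big.
pose c n := rnorm (T (v n)); pose e n := (c n)^-1%:C *: T (v n).
(* Since [g n w = <v n, S w>], these maps are bounded pointwise by the norm of [S w], whereas [g n]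
   has value of norm [c n] at the unit vector [e n]. *)
pose g n w : A := inner (T (v n)) w.
have c0 n : 0 < c n by apply: le_lt_trans (vP n).2; rewrite exprn_ge0.
have e1 n : rnorm (e n) = 1.
  by rewrite rnormZ cmod_real gtr0_norm ?invr_gt0 // mulVf // gt_eqF.
have gD n w w' : g n (w + w') = g n w + g n w' by exact: innerDr.
have gN n w : g n (- w) = - g n w by exact: innerNr.
have ge n : rnorm (g n (e n)) = c n.
  rewrite /g innerZr rnormZ cmod_real gtr0_norm ?invr_gt0 // rnorm_inner expr2.
  by rewrite mulKf // gt_eqF.
have g_le n w : rnorm (g n w) <= c n * rnorm w by exact: rnorm_inner_le.
(* Ratio 3 keeps the tail after step [n] below [t n / 2], so half of the hump survives; as
   [4 ^+ n < c n], the humps [t n * c n] still grow at least like [(4 / 3) ^+ n]. *)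
pose t n : R := 3^-1 ^+ n.
have t0 n : 0 < t n by rewrite exprn_gt0 // invr_gt0.
have tS n : t n.+1 = 3^-1 * t n by rewrite /t exprS.
pose xi n := (t n)%:C *: e n.
have xi_norm n : rnorm (xi n) = t n.
  by rewrite rnormZ e1 cmod_real gtr0_norm // mulr1.
have gxi n : rnorm (g n (xi n)) = t n * c n.
  by rewrite /g innerZr rnormZ cmod_real gtr0_norm // -/(g n _) ge.
(* One of the two signs succeeds, because the values of [g n] at the two candidates differ by
   [2 *: g n (xi n)]. *)
pose step n x :=
  if t n * c n <= rnorm (g n (x + xi n)) then x + xi n else x - xi n.
pose u := fix u n := if n is n'.+1 then step n' (u n') else 0.
have uS n : rnorm (u n.+1 - u n) <= t n.
  rewrite /= /step; case: ifP => _.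
    by rewrite addrAC subrr add0r xi_norm.
  by rewrite addrAC subrr add0r rnormN xi_norm.
have gu n : t n * c n <= rnorm (g n (u n.+1)).
  rewrite /= /step; case: ifPn => //; rewrite -ltNge => lt.
  have := rnormD (g n (u n + xi n)) (- g n (u n - xi n)).
  rewrite rnormN; have -> : g n (u n + xi n) - g n (u n - xi n) = 2 *: g n (xi n).
    by rewrite !gD gN; lmod R[i] A.
  have c2 : cmod (2 : R[i]) = 2.
    by rewrite -(rmorph_nat (real_complex R) 2) cmod_real ger0_norm.
  by rewrite rnormZ gxi c2; move: lt; lra.
have um n m : (n <= m)%N -> rnorm (u m - u n) <= 3 / 2 * (t n - t m).
  elim: m => [|m IH]; first by rewrite leqn0 => /eqP->; rewrite !subrr rnorm0 mulr0.
  rewrite leq_eqVlt => /predU1P[<-|]; first by rewrite !subrr rnorm0 mulr0.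
  rewrite ltnS => /IH H; rewrite -(subrKA (u m)).
  apply: le_trans (rnormD _ _) _; have := uS m; rewrite tS.
  move: H; lra.
have [x xu] : exists x, forall n, rnorm (x - u n) <= 3 / 2 * t n.
  apply: rnorm_cauchy_limit => [n m nm|d d0].
    apply: le_trans (um _ _ nm) _; have := t0 m; have := t0 n; lra.
  have [n dn] := @expr_unbounded R 3 (2 / d) ltac:(lra).
  exists n; rewrite /t exprVn.
  have p0 : 0 < 3 ^+ n :> R by rewrite exprn_gt0.
  rewrite ltr_pdivrMr //; move: dn; rewrite ltr_pdivrMr //; nra.
have gx n : 2^-1 * t n * c n <= rnorm (g n x).
  have -> : x = u n.+1 + (x - u n.+1) by rewrite addrC subrK.
  have := rnormD (g n x) (- g n (x - u n.+1)).
  have -> : g n x - g n (x - u n.+1) = g n (u n.+1).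
    by rewrite gD gN; lmod R[i] A.
  rewrite rnormN addrCA subrr addr0 => tri.
  have := g_le n (x - u n.+1); have := xu n.+1; rewrite tS => h1 h2.
  have := gu n; have := c0 n; have := t0 n => h3 h4 h5.
  have : c n * rnorm (x - u n.+1) <= c n * (3 / 2 * (3^-1 * t n)).
    by rewrite ler_pM2l.
  lra.
have [n qn] := @expr_unbounded R (4 / 3) (2 * rnorm (S x)) ltac:(lra).
have : rnorm (g n x) <= rnorm (S x).
  rewrite /g TS (le_trans (rnorm_inner_le _ _)) // ler_piMl ?rnorm_ge0 //.
  exact: (vP n).1.
have := gx n; have : (4 / 3) ^+ n <= t n * c n.
  rewrite exprMn mulrC /t ler_pM2l ?exprn_gt0 ?invr_gt0 //.
  exact: ltW (vP n).2.
move: qn; lra.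
Qed.

End AdjointableBounded.

(** * States of the linking algebra *)

Section Linking.
Context (R : realType) (A : cstarAlgType R) (V : hilbertModType A).
Implicit Types (x y : V) (a : A) (z w : A * V).

Let SA := hilbert_semi_inner A.
Let SV := hilbert_semi_inner V.
Let SI := pair_semi_inner V.

Lemma theta_adjoint x y : adjoint (theta x y : V -> V) (theta y x).
Proof.
by move=> z w; rewrite /theta inner_ractl inner_ract inner_star.
Qed.

Lemma opnorm0_le (W W' : hilbertModType A) : opnorm (0 : W -> W') <= 0.
Proof. by apply: opnorm_le => // z; rewrite hnormE rnorm0 mul0r. Qed.

Lemma compact_map0 : compact_map (0 : V -> V).
Proof.
split; first by exists 0 => z w; rewrite inner0l inner0r.
move=> e e0; exists 0%N, (fun _ => 0), (fun _ => 0), (fun _ => 0).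
by rewrite big_ord0 subr0 (le_lt_trans (opnorm0_le _ _)).
Qed.

Lemma compact_theta x y : compact_map (theta x y : V -> V).
Proof.
split; first by exists (theta y x); exact: theta_adjoint.
move=> e e0; exists 1%N, (fun _ => 1), (fun _ => x), (fun _ => y).
by rewrite big_ord1 scale1r subrr (le_lt_trans (opnorm0_le _ _)).
Qed.

Definition raise x : A * V -> A * V := blockop 0 0 (rmap x) 0.
Definition lower x : A * V -> A * V := blockop 0 (lmap x) 0 0.
Definition swap x : A * V -> A * V := blockop 0 (lmap x) (rmap x) 0.

Lemma lmul0 : lmul (0 : A) = 0.
Proof. by apply/funext => b; rewrite /lmul cmul0l. Qed.

Lemma lmap0 : lmap (0 : V) = 0.
Proof. by apply/funext => b; rewrite /lmap inner0l. Qed.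

Lemma rmap0 : rmap (0 : V) = 0.
Proof. by apply/funext => b; rewrite /rmap ract0l. Qed.

Lemma linking_blockop a y x (T : V -> V) : compact_map T ->
  linking (blockop (lmul a) (lmap y) (rmap x) T).
Proof. by move=> cT; exists a, x, y, T. Qed.

Lemma linking_swap x : linking (swap x).
Proof. by rewrite /swap -lmul0; apply: linking_blockop; exact: compact_map0. Qed.

Lemma linking_raise x : linking (raise x).
Proof.
by rewrite /raise -lmul0 -lmap0; apply: linking_blockop; exact: compact_map0.
Qed.

Lemma linking_lower x : linking (lower x).
Proof.
by rewrite /lower -lmul0 -rmap0; apply: linking_blockop; exact: compact_map0.
Qed.

Lemma blockop0 : blockop 0 0 0 0 = 0 :> (A * V -> A * V).
Proof. by apply/funext => z; rewrite /blockop /= !addr0. Qed.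

Lemma linking0 : linking (0 : A * V -> A * V).
Proof.
by rewrite -blockop0 -lmul0 -lmap0 -rmap0; apply: linking_blockop; exact: compact_map0.
Qed.

Lemma swapE x : swap x = lower x + raise x.
Proof.
apply/funext => z; congr pair => /=; first by rewrite !addr0.
by rewrite !add0r addr0.
Qed.

Lemma raiseD x y : raise (x + y) = raise x + raise y.
Proof.
apply/funext => z; congr pair => /=; rewrite ?addr0 //.
by rewrite /rmap ractDl.
Qed.

Lemma raiseZ (k : R[i]) x : raise (k *: x) = k *: raise x.
Proof.
apply/funext => z; congr pair => /=; rewrite ?addr0 ?scaler0 //.
by rewrite /rmap ractZl.
Qed.

Lemma lowerD x y : lower (x + y) = lower x + lower y.
Proof.
apply/funext => z; congr pair => /=; rewrite ?addr0 //.
by rewrite !add0r /lmap (si_Dl SV).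
Qed.

Lemma lowerZ (k : R[i]) x : lower (k *: x) = conjc k *: lower x.
Proof.
apply/funext => z; congr pair => /=; rewrite ?addr0 ?scaler0 //.
by rewrite !add0r /lmap (si_Zl SV).
Qed.

Lemma swapZ (t : R) x : swap (t%:C *: x) = t%:C *: swap x.
Proof.
have tJ : conjc t%:C = t%:C by exact: conjc_real.
by rewrite !swapE raiseZ lowerZ tJ scalerDr.
Qed.

Lemma hnorm_swap x z : hnorm (swap x z) <= rnorm x * hnorm z.
Proof.
apply: hnorm_le_pf => [|psi pf]; first exact: rnorm_ge0.
rewrite !inner_pair /= add0r addr0 !(pfD pf) !raddfD /= addrC mulrDr lerD //.
  exact: pf_ract_le.
exact: pf_inner_le.
Qed.

End Linking.

(** * Approximate units acting on a vector *)

Section ApproximateUnit.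
Context (R : realType) (A : cstarAlgType R) (V : hilbertModType A).

(* [u = 1 - (1 - <x, x>) ^ n] for large [n]. *)
Lemma approx_unit (x : V) (e : R) : 0 < e ->
  exists u : A, rnorm (x - ract x u) <= e.
Proof.
move=> e0; wlog x1 : x e e0 / rnorm x <= 1.
  move=> W; have [/W|x1] := leP (rnorm x) 1; first exact.
  have x0 : 0 < rnorm x by rewrite (lt_trans ltr01).
  have [||u uP] := W ((rnorm x)^-1%:C *: x) (e / rnorm x).
  - exact: divr_gt0.
  - by rewrite rnormZ cmod_real gtr0_norm ?invr_gt0 // mulVf // gt_eqF.
  exists u; move: uP; rewrite ractZl -scalerBr rnormZ cmod_real.
  by rewrite gtr0_norm ?invr_gt0 // mulrC ler_pM2r ?invr_gt0.
have US := cstar_seminorm_unitization A.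
pose h : A := inner x x; have ph : apos h by exact: (si_pos (hilbert_semi_inner V)).
have h1 : unorm (emb h) <= 1.
  by rewrite unorm_emb rnorm_inner exprn_ile1 // rnorm_ge0.
have [n nP] := @expr_unbounded R 2 (1 / e ^+ 2) ltac:(lra).
pose k := (2 ^ n)%N; pose m : unitization A := 1 - emb h.
have sm : ustar m = m.
  by rewrite /m (starB US) (star1 US); have [-> _] := ph.
have [u uE] : exists u, m ^+ k = 1 - emb u.
  elim: k => [|k [u uE]]; first by exists 0; rewrite expr0 /emb subr0.
  exists (h + u - cmul h u); rewrite exprS uE /m.
  rewrite !embD embN embM mulrBl mul1r mulrBr mulr1.
  by lmod R (unitization A).
exists u; rewrite -(@ler_pXn2r _ 2) ?nnegrE ?rnorm_ge0 ?(ltW e0) //.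
rewrite -rnorm_inner -unorm_emb.
(* Here [1 - u = m ^ k], so the inner product is [m ^ k h m ^ k], and [m] commutes with [h];
   [snorm_decay] makes it of order [1 / 2k]. *)
have -> : emb (inner (x - ract x u) (x - ract x u) : A) =
    emb h * (1 - emb h) ^+ (k + k).
  have SV := hilbert_semi_inner V.
  rewrite (si_Dl SV) !innerDr -[- ract x u]scaleN1r -!ractZl.
  rewrite !inner_ract !inner_ractl !innerZr !(si_Zl SV).
  rewrite rmorphN rmorph1 !scaleN1r opprK.
  have mh : emb h * (1 - emb h) ^+ k = (1 - emb h) ^+ k * emb h.
    by apply: commrX; apply: commrB => //; exact: commr1.
  rewrite exprD mulrA mh -/m -{1}sm -(starX US) uE.
  rewrite (starB US) (star1 US) -emb_star -/h.
  rewrite !mulrBl !mul1r !mulrBr !mulr1 -!embM -!embN -!embD.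
  rewrite -embN -embD; congr emb; rewrite cmulNl cmulNr.
  by lmod R[i] A.
have := snorm_decay US (k + k) ph h1.
have k1 : 1 / e ^+ 2 < (k + k)%:R.
  apply: lt_le_trans nP _; rewrite -natrX ler_nat; exact: leq_addr.
move: (unorm _) (unorm_ge0 (emb h * (1 - emb h) ^+ (k + k))) => N N0 kN.
rewrite -(ler_pM2l (_ : 0 < 1 / e ^+ 2)) ?divr_gt0 ?exprn_gt0 //.
rewrite [X in _ <= X]divfK ?gt_eqF ?exprn_gt0 //.
by apply: le_trans kN; rewrite ler_wpM2r // ltW.
Qed.

End ApproximateUnit.

(** * States are hermitian on the off-diagonal corners *)

Section State.
Context (R : realType) (A : cstarAlgType R) (V : hilbertModType A).
Context (phi : (A * V -> A * V) -> R[i]) (st : state phi).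
Implicit Types (x y : V) (a u : A) (S T : A * V -> A * V).

Lemma st0 : phi 0 = 0.
Proof.
case: st => lin _ _; have := lin 1 0 0 (linking0 V) (linking0 V).
by rewrite scale1r addr0 mul1r => /esym/eqP; rewrite -subr_eq0 addrK => /eqP.
Qed.

Lemma stD S T : linking S -> linking T -> phi (S + T) = phi S + phi T.
Proof. by case: st => lin _ _ LS LT; rewrite -[S]scale1r lin // mul1r scale1r. Qed.

Lemma stZ k S : linking S -> phi (k *: S) = k * phi S.
Proof.
by case: st => lin _ _ LS; rewrite -[k *: S]addr0 lin ?st0 ?addr0 //; exact: linking0.
Qed.

Lemma st_le1 S : linking S -> opnorm S <= 1 -> cmod (phi S) <= 1.
Proof.
case: st => _ _; set E := (X in sup X) => supE LS S1; rewrite -supE.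
(* A supremum equal to 1 is not the default value 0, so [E] is bounded. *)
have [sE|] := asboolP (has_sup E); last first.
  by move/sup_out; rewrite supE => /eqP; rewrite oner_eq0.
by apply: ub_le_sup; [case: sE|exists S].
Qed.

Lemma st_family_le (F : V -> A * V -> A * V) :
  (forall x, linking (F x)) ->
  (forall (t : R) x, F (t%:C *: x) = t%:C *: F x) ->
  (forall x z, hnorm (F x z) <= rnorm x * hnorm z) ->
  forall x, cmod (phi (F x)) <= rnorm x.
Proof.
move=> LF FZ Fle x; have [x0|x0] := eqVneq (rnorm x) 0.
  have -> : F x = 0.
    by rewrite (rnorm_eq0 x0) -(scale0r (0 : V)) (FZ 0) scale0r.
  by rewrite st0 x0 /cmod normr0.
have x1 : 0 < rnorm x by rewrite lt_def x0 rnorm_ge0.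
rewrite -(mulr1 (rnorm x)) -ler_pdivrMl //.
have -> : (rnorm x)^-1 * cmod (phi (F x)) = cmod (phi (F ((rnorm x)^-1%:C *: x))).
  by rewrite FZ stZ // cmodM cmod_real gtr0_norm ?invr_gt0.
apply: st_le1 => //; apply: opnorm_le => // z; rewrite (le_trans (Fle _ _)) //.
by rewrite rnormZ cmod_real gtr0_norm ?invr_gt0 // mulVf.
Qed.

Lemma st_pos_Im S S' : linking S -> linking S' -> adjoint S S' ->
  complex.Im (phi (S' \o S)) = 0.
Proof. by case: st => _ pos _ LS LS' SS'; apply: ger0_Im; exact: pos. Qed.

Definition diag a (T : V -> V) : A * V -> A * V := blockop (lmul a) 0 0 T.

Lemma linking_diag a (K : V -> V) : compact_map K -> linking (diag a K).
Proof. by move=> cT; rewrite /diag -lmap0 -rmap0; exact: linking_blockop. Qed.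

(** Both diagonal blocks are products of an element with its adjoint: [u^* u], and [raise x] after
    [lower x]. *)
Lemma st_Im_diag x u :
  complex.Im (phi (diag (cmul (cstar u) u) (theta x x))) = 0.
Proof.
have SA := hilbert_semi_inner A.
have c0 := compact_map0 V; have cT := compact_theta x x.
have -> : diag (cmul (cstar u) u) (theta x x) =
    (diag (cstar u) 0 \o diag u 0) + (raise x \o lower x).
  apply/funext => -[a v]; congr pair => /=; rewrite ?addr0 ?add0r //.
  by rewrite /lmul cmulA.
have E1 : diag (cstar u) 0 \o diag u 0 = diag (cmul (cstar u) u) 0.
  apply/funext => -[a v]; congr pair => /=; rewrite ?addr0 //.
  by rewrite /lmul cmulA.
have E2 : raise x \o lower x = diag 0 (theta x x).
  apply/funext => -[a v]; congr pair => /=; rewrite ?addr0 ?add0r //.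
  by rewrite lmul0.
rewrite stD ?raddfD /=; last 2 first.
- by rewrite E1; exact: linking_diag.
- by rewrite E2; exact: linking_diag.
rewrite !st_pos_Im ?addr0 //; try exact: linking_diag.
- exact: linking_lower.
- exact: linking_raise.
- move=> [a v] [b w]; rewrite !inner_pair /= !addr0 inner0l inner0r !addr0 !add0r.
  by rewrite /rmap inner_ract /inner /= /lmap inner_star.
move=> [a v] [b w]; rewrite !inner_pair /= !addr0 inner0l inner0r !addr0.
by rewrite /inner /= /lmul cstarM cmulA.
Qed.

(* The polarization identity for [S = u + lower x]. *)
Lemma st_Im_ract x u : complex.Im (phi (swap (ract x u))) = 0.
Proof.
have SA := hilbert_semi_inner A.
have c0 := compact_map0 V; have cT := compact_theta x x.
pose S : A * V -> A * V := blockop (lmul u) (lmap x) 0 0.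
pose S' : A * V -> A * V := blockop (lmul (cstar u)) 0 (rmap x) 0.
have LS : linking S by rewrite /S -rmap0; exact: linking_blockop.
have LS' : linking S' by rewrite /S' -lmap0; exact: linking_blockop.
have SS' : adjoint S S'.
  move=> [a v] [b w]; rewrite !inner_pair /= !addr0 inner0l addr0.
  rewrite (si_Dl SA) /rmap (@inner_ract _ _ V); congr (_ + _).
    by rewrite /inner /= /lmul cstarM cmulA.
  by rewrite /inner /= /lmap inner_star.
have := st_pos_Im LS LS' SS'.
have -> : S' \o S = diag (cmul (cstar u) u) (theta x x) + swap (ract x u).
  apply/funext => -[a v]; congr pair => /=; rewrite ?addr0 ?add0r.
    by rewrite /lmul /lmap cmulDr !cmulA inner_ractl.
  by rewrite /rmap /lmul /lmap /theta ractDr ractM addrC.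
rewrite stD ?raddfD /=; [|exact: linking_diag|exact: linking_swap].
by rewrite st_Im_diag add0r.
Qed.

Lemma st_Im_swap x : complex.Im (phi (swap x)) = 0.
Proof.
apply/eqP; rewrite -normr_eq0; apply/eqP/le_anti; rewrite normr_ge0 andbT.
apply/ler_addgt0Pr => e e0; rewrite add0r.
have [u uP] := approx_unit x e0.
have -> : swap x = swap (x - ract x u) + swap (ract x u).
  by rewrite !swapE addrACA -lowerD -raiseD subrK.
rewrite stD ?raddfD /=; [|exact: linking_swap|exact: linking_swap].
rewrite st_Im_ract addr0 (le_trans _ uP) //.
apply: le_trans (st_family_le (@linking_swap _ _ V) (@swapZ _ _ V) (@hnorm_swap _ _ V) _).
by rewrite /cmod normc_def /= -sqrtr_sqr ler_wsqrtr // lerDr sqr_ge0.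
Qed.

(** Reality at [swap x] matches the imaginary parts; at [swap ('i *: x)], which is ['i] times
    [raise x - lower x], it matches the real parts. *)
Lemma st_lower x : phi (lower x) = conjc (phi (raise x)).
Proof.
have L z : linking (lower z) by exact: linking_lower.
have Rr z : linking (raise z) by exact: linking_raise.
have := st_Im_swap ('i *: x); have := st_Im_swap x.
rewrite !swapE !stD // raiseZ lowerZ !stZ //.
case: (phi (lower x)) (phi (raise x)) => a b [c d] /= h1 h2.
apply/eqP; rewrite eq_complex /=; apply/andP; split; apply/eqP; lra.
Qed.

(** After a rotation of [x] making [phi (raise x)] nonnegative, [phi] at the corresponding [swap] is
    twice that value; this is the origin of the factor 1/2. *)
Lemma st_raise_le x : cmod (phi (raise x)) <= rnorm x / 2.
Proof.
have [w w1 wE] := exists_phase (phi (raise x)).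
have := st_family_le (@linking_swap _ _ V) (@swapZ _ _ V) (@hnorm_swap _ _ V) (w *: x).
rewrite rnormZ w1 mul1r swapE stD; [|exact: linking_lower|exact: linking_raise].
rewrite st_lower raiseZ stZ; last exact: linking_raise.
rewrite wE [conjc _]conjc_real -rmorphD /= cmod_real ger0_norm; first lra.
by rewrite addr_ge0 // cmod_ge0.
Qed.

End State.

Lemma Omega_le (R : realType) (A : cstarAlgType R) (V : hilbertModType A) (x : V) :
  Omega x <= rnorm x / 2.
Proof.
rewrite /Omega; set E := (X in sup X).
have [->|/set0P E0] := eqVneq E set0.
  by rewrite sup0 divr_ge0 // rnorm_ge0.
by apply: ge_sup => // _ [phi st <-]; exact: (st_raise_le st).
Qed.

(** * A vector state attaining half the norm *)

Section VectorState.
Context (R : realType) (A : cstarAlgType R) (V : hilbertModType A).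
Implicit Types (x : V) (S : A * V -> A * V).

Let SA := hilbert_semi_inner A.
Let SV := hilbert_semi_inner V.
Let SI := pair_semi_inner V.

Lemma hnorm_pair_le (z : A * V) : hnorm z <= rnorm z.1 + rnorm z.2.
Proof.
have z1 := rnorm_ge0 z.1; have z2 := rnorm_ge0 z.2.
rewrite -(@ler_pXn2r _ 2) ?nnegrE ?hnorm_ge0 ?addr_ge0 //.
rewrite hnorm_sqr inner_pair (le_trans (rnormD _ _)) // !rnorm_inner.
by have := mulr_ge0 z1 z2; nra.
Qed.

Lemma linking_opnorm S : linking S ->
  forall z, hnorm (S z) <= opnorm S * hnorm z.
Proof.
move=> [a [x [y [T [[[T' TT'] _] ->]]]]].
have [M TM] := adjoint_bounded TT'.
apply: (@le_opnorm _ _ _ _ _ (rnorm a + rnorm y + rnorm x + `|M|)).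
- by move=> t z; rewrite (hnormZ SI) cmod_real.
- move=> t z; rewrite -cmod_real -(hnormZ SI); congr hnorm; congr pair => /=.
    by rewrite /lmul /lmap cmulZr innerZr scalerDr.
  by rewrite /rmap ractZr (adjoint_scale TT') scalerDr.
move=> z; apply: le_trans (hnorm_pair_le _) _ => /=.
have z1 := hnorm_fst z; have z2 := hnorm_snd z.
have le (c : R) (u v : R) : 0 <= c -> u <= v -> c * u <= c * v.
  by move=> c0 uv; rewrite ler_wpM2l.
have h1 := rnormM a z.1; have h2 := rnorm_inner_le y z.2.
have h3 := rnorm_ract x z.1; have h4 := TM z.2.
have h5 : M * rnorm z.2 <= `|M| * rnorm z.2.
  by rewrite ler_wpM2r ?rnorm_ge0 // ler_norm.
have h6 := rnormD (cmul a z.1) (inner y z.2 : A).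
have h7 := rnormD (ract x z.1) (T z.2).
have k1 := le _ _ _ (rnorm_ge0 a) z1; have k2 := le _ _ _ (rnorm_ge0 y) z2.
have k3 := le _ _ _ (rnorm_ge0 x) z1; have k4 := le _ _ _ (normr_ge0 M) z2.
rewrite /lmul /lmap /rmap; lra.
Qed.

(* The functional [S |-> psi <z, S z> / 2] for [z = (h, x h)], [h = <x, x>] and
   a state [psi] of [A] with [psi (h ^ 2) = 1]: then [psi h = psi (h ^ 3) = 1]
   as well. *)
Lemma exists_state x : rnorm x = 1 ->
  exists2 phi, state phi & phi (raise x) = 2^-1.
Proof.
move=> x1; pose h : A := inner x x.
have sh : cstar h = h by exact: inner_star.
have h1 : rnorm h = 1 by rewrite /h rnorm_inner x1 expr1n.
pose h2 : A := cmul h h; pose h3 : A := cmul h2 h.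
have h2E : h2 = cmul (cstar h) h by rewrite sh.
have h21 : rnorm h2 = 1 by rewrite h2E rnorm_starM h1 expr1n.
have ph2 : apos h2 by rewrite h2E; exact: apos_starM.
have [psi pf psih2] := exists_positive_functional ph2.
rewrite h21 in psih2.
have h31 : rnorm h3 <= 1 by rewrite (le_trans (rnormM _ _)) // h1 h21 mulr1.
have in2 : inner (ract x h) (ract x h) = h3.
  by rewrite inner_ract inner_ractl sh.
have psih3 : psi h3 = 1.
  (* This reads [1 <= psi h * psi h3], with both factors at most 1. *)
  have := pf_cauchy_schwarz SV pf x (ract x h).
  rewrite in2 inner_ract -/h -/h2 psih2 cmod_real normr1 expr1n.
  have p3 : apos h3 by rewrite -in2; exact: (si_pos SV).
  have := pf_Re_ge0 pf p3; have := pf_Re_ge0 pf (si_pos SV x).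
  have := pf_Re_le pf h3; have := pf_Re_le pf h; rewrite h1 -/h.
  rewrite [psi h3](pf_apos pf p3) /=.
  move: (complex.Re (psi h)) (complex.Re (psi h3)) => s t s1 t1 s0 t0 st.
  have -> : t = 1 by nra.
  by [].
pose z : A * V := (h, ract x h).
have zz : inner z z = h2 + h3 :> A by rewrite inner_pair in2 /inner /= sh.
have psiz : psi (inner z z) = 2.
  by rewrite zz (pfD pf) psih2 psih3.
have hz : hnorm z ^+ 2 <= 2.
  rewrite hnorm_sqr zz (le_trans (rnormD _ _)) // h21; lra.
have Re2 : complex.Re (2 : R[i]) = 2.
  by rewrite -(rmorph_nat (real_complex R) 2).
(* The factor normalizes [psi (inner z z) = 2]. *)
pose phi S := 2^-1 * psi (inner z (S z)).
have phi_le S : linking S -> opnorm S <= 1 -> cmod (phi S) <= 1.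
  move=> LS S1; have := pf_cauchy_schwarz SI pf z (S z).
  rewrite psiz => cs.
  have n1 : hnorm (S z) <= hnorm z.
    by rewrite (le_trans (linking_opnorm LS z)) // ler_piMl ?hnorm_ge0.
  have n2 : hnorm (S z) ^+ 2 <= 2.
    by apply: le_trans hz; rewrite ler_pXn2r ?nnegrE ?hnorm_ge0.
  have n3 := pf_Re_inner_le pf (S z).
  have n4 := pf_Re_ge0 pf (si_pos SI (S z)).
  have : cmod (psi (inner z (S z))) ^+ 2 <= 2 ^+ 2.
    by apply: le_trans cs _; rewrite Re2; lra.
  rewrite ler_pXn2r ?nnegrE ?cmod_ge0 // => c2.
  have half : cmod (2^-1 : R[i]) = 2^-1.
    by rewrite -(rmorph_nat (real_complex R) 2) -fmorphV cmod_real ger0_norm.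
  rewrite /phi cmodM half; lra.
have phi_swap : phi (swap x) = 1.
  rewrite /phi inner_pair /= add0r addr0 (pfD pf) /rmap in2 /lmap inner_ract.
  have -> : inner h (cmul (inner x x) h) = h3 :> A.
    by rewrite /inner /= sh cmulA.
  by rewrite psih3 mulVf // pnatr_eq0.
exists phi; last first.
  rewrite /phi inner_pair /= !addr0 inner0r add0r /rmap in2 psih3 mulr1.
  by [].
split.
- move=> k S T _ _; rewrite /phi; have -> : (k *: S + T) z = k *: S z + T z by [].
  by rewrite (si_Dr SI) (si_Zr SI) (pfD pf) (pfZ pf); ring.
- move=> S S' _ _ SS'; rewrite /phi /= -SS' mulr_ge0 ?invr_ge0 //.
  exact: pf_pos (si_pos SI _).
apply/le_anti/andP; split.
  apply: ge_sup => [|_ [S [LS S1] <-]]; last exact: phi_le.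
  exists (cmod (phi 0)); exists 0 => //=; split; first exact: linking0.
  apply: le_trans (_ : 0 <= 1) => //; apply: opnorm_le => // w.
  rewrite mul0r; have -> : (0 : A * V -> A * V) w = 0%:C *: w by rewrite scale0r.
  by rewrite (hnormZ SI) /cmod normr0 mul0r.
(* The norm 1 is attained at [swap x], a contraction as [rnorm x = 1]. *)
apply: ub_le_sup; last first.
  exists (swap x); last first.
    by rewrite phi_swap -/(cmod _) -(rmorph1 (real_complex R)) cmod_real normr1.
  split; first exact: linking_swap.
  by apply: opnorm_le => // w; rewrite -{1}x1 hnorm_swap.
by exists 1 => _ [S [LS S1] <-]; exact: phi_le.
Qed.

Lemma le_Omega x : rnorm x / 2 <= Omega x.
Proof.
rewrite /Omega; set E := (X in sup X).
have Eub : has_ubound E.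
  by exists (rnorm x / 2) => _ [phi st <-]; exact: (st_raise_le st).
have [x0|x0] := eqVneq (rnorm x) 0.
  rewrite x0 mul0r; have [->|/set0P[r Er]] := eqVneq E set0; first by rewrite sup0.
  apply: le_trans (ub_le_sup Eub Er); have [phi _ <-] := Er.
  exact: cmod_ge0.
have x1 : 0 < rnorm x by rewrite lt_def x0 rnorm_ge0.
have [|phi st phix] := @exists_state ((rnorm x)^-1%:C *: x).
  by rewrite rnormZ cmod_real gtr0_norm ?invr_gt0 // mulVf.
apply: ub_le_sup => //; exists phi => //=.
have xE : x = (rnorm x)%:C *: ((rnorm x)^-1%:C *: x).
  by rewrite scalerA -rmorphM /= divff // scale1r.
change (cmod (phi (raise x)) = rnorm x / 2).
rewrite [raise x](_ : _ = (rnorm x)%:C *: raise ((rnorm x)^-1%:C *: x)).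
  rewrite (stZ st); last exact: linking_raise.
  rewrite phix cmodM cmod_real gtr0_norm // -(rmorph_nat (real_complex R) 2).
  by rewrite -fmorphV cmod_real ger0_norm ?invr_ge0.
by rewrite {1}xE raiseZ.
Qed.

Lemma OmegaE x : Omega x = rnorm x / 2.
Proof. by apply/le_anti; rewrite Omega_le le_Omega. Qed.

End VectorState.

(** * The norm of a sum *)

(* A word in [f] and [g] is estimated by grouping adjacent letters [f g] and
   [g f], each pair costing [d ^ 2].  This is at most the product of the entries
   of [[a, d], [d, b]] read along the word, so [(f + g) ^ n] grows no faster
   than the powers of that matrix. *)
Lemma sum_iter_bound (R : realType) (X : zmodType) (nrm : X -> R) (f g : X -> X)
    (a b d u v l : R) (e : X) :
  (forall z w, nrm (z + w) <= nrm z + nrm w) ->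
  (forall z, 0 <= nrm z) ->
  (forall z w, f (z + w) = f z + f w) -> (forall z w, g (z + w) = g z + g w) ->
  (forall z, nrm (f z) <= a * nrm z) -> (forall z, nrm (g z) <= b * nrm z) ->
  (forall z, nrm (f (g z)) <= d ^+ 2 * nrm z) ->
  (forall z, nrm (g (f z)) <= d ^+ 2 * nrm z) ->
  0 < a -> 0 < b -> 0 <= d -> d ^+ 2 <= a * b -> 0 < u -> 0 < v ->
  a * u + d * v <= l * u -> d * u + b * v <= l * v ->
  exists2 C, 0 <= C & forall n, nrm (iter n (fun z => f z + g z) e) <= C * l ^+ n.
Proof.
move=> nD n0 fD gD fa gb fgd gfd a0 b0 d0 dab u0 v0 lu lv.
pose al := Num.sqrt a; pose be := Num.sqrt b.
have al0 : 0 < al by rewrite sqrtr_gt0.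
have be0 : 0 < be by rewrite sqrtr_gt0.
have al2 : al ^+ 2 = a by rewrite sqr_sqrtr // ltW.
have be2 : be ^+ 2 = b by rewrite sqr_sqrtr // ltW.
have dle : d <= al * be.
  rewrite -(@ler_pXn2r _ 2) ?nnegrE ?mulr_ge0 ?(ltW al0) ?(ltW be0) //.
  by rewrite exprMn al2 be2.
have l0 : 0 < l.
  rewrite -(pmulr_lgt0 _ u0); apply: lt_le_trans lu.
  by rewrite ltr_pwDl ?mulr_gt0 // mulr_ge0 // ltW.
pose C := nrm e * (al / u + be / v).
have C0 : 0 <= C by rewrite mulr_ge0 // addr_ge0 // divr_ge0 // ltW.
have Cu : nrm e * al <= C * u.
  rewrite /C -mulrA ler_wpM2l // mulrDl divfK ?gt_eqF // lerDl.
  by rewrite mulr_ge0 ?divr_ge0 ?ltW.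
have Cv : nrm e * be <= C * v.
  rewrite /C -mulrA ler_wpM2l // mulrDl divfK ?gt_eqF // lerDr.
  by rewrite mulr_ge0 ?divr_ge0 ?ltW.
pose t n := iter n (fun z => f z + g z) e.
have dd z : nrm (f (g z)) <= d * (al * be * nrm z) /\
    nrm (g (f z)) <= d * (al * be * nrm z).
  have le : d ^+ 2 * nrm z <= d * (al * be * nrm z).
    by rewrite expr2 -mulrA ler_wpM2l // ler_wpM2r.
  by split; [exact: le_trans (fgd z) le|exact: le_trans (gfd z) le].
(* Each adjacent pair of letters is charged an entry of the matrix, and each end of the word the
   square root of the diagonal entry of its letter; [d <= al * be] pays for a grouped pair. The
   vector [(u, v)] bounds the sum over words, since the matrix maps it below [l] times itself. *)
have key n : [/\ nrm (f (t n)) <= al * (C * u * l ^+ n),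
    nrm (g (t n)) <= be * (C * v * l ^+ n),
    nrm (f (g (t n))) <= al * (d * (C * v * l ^+ n))
    & nrm (g (f (t n))) <= be * (d * (C * u * l ^+ n))].
  elim: n => [|n [h1 h2 h3 h4]].
    rewrite !expr0 !mulr1 /=; split.
    - apply: le_trans (fa e) _; rewrite -al2 expr2 -mulrA ler_pM2l //.
      by rewrite mulrC.
    - apply: le_trans (gb e) _; rewrite -be2 expr2 -mulrA ler_pM2l //.
      by rewrite mulrC.
    - apply: le_trans (dd e).1 _.
      by have := ler_wpM2l (mulr_ge0 d0 (ltW al0)) Cv; lra.
    - apply: le_trans (dd e).2 _.
      by have := ler_wpM2l (mulr_ge0 d0 (ltW be0)) Cu; lra.
  have -> : t n.+1 = f (t n) + g (t n) by [].
  rewrite !fD !gD !fD exprS.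
  have L0 : 0 < l ^+ n by rewrite exprn_gt0.
  move: (l ^+ n) L0 h1 h2 h3 h4 => L L0 h1 h2 h3 h4.
  have CL : 0 <= C * L by rewrite mulr_ge0 // ltW.
  have lu' := ler_wpM2l CL lu; have lv' := ler_wpM2l CL lv.
  have ffP : nrm (f (f (t n))) <= al * (a * (C * u * L)).
    by rewrite mulrCA (le_trans (fa _)) // ler_pM2l.
  have ggP : nrm (g (g (t n))) <= be * (b * (C * v * L)).
    by rewrite mulrCA (le_trans (gb _)) // ler_pM2l.
  have dPQ : d * (nrm (f (t n)) + nrm (g (t n))) <=
      d * (al * (C * u * L) + be * (C * v * L)).
    by rewrite ler_wpM2l // lerD.
  have CuL : 0 <= C * u * L by exact: mulr_ge0 (mulr_ge0 C0 (ltW u0)) (ltW L0).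
  have CvL : 0 <= C * v * L by exact: mulr_ge0 (mulr_ge0 C0 (ltW v0)) (ltW L0).
  have dal : d * al <= be * a.
    by rewrite -al2 expr2 mulrA ler_pM2r // mulrC.
  have dbe : d * be <= al * b.
    by rewrite -be2 expr2 mulrA ler_pM2r.
  have dal' := ler_wpM2r CuL dal; have dbe' := ler_wpM2r CvL dbe.
  have P3 : d * (al * (C * u * L) + be * (C * v * L)) <= al * (C * v * (l * L)).
    have := ler_wpM2l (ltW al0) lv'; lra.
  have P4 : d * (al * (C * u * L) + be * (C * v * L)) <= be * (C * u * (l * L)).
    have := ler_wpM2l (ltW be0) lu'; lra.
  split.
  - apply: le_trans (nD _ _) _; apply: le_trans (lerD ffP h3) _.
    have := ler_wpM2l (ltW al0) lu'; lra.
  - apply: le_trans (nD _ _) _; apply: le_trans (lerD h4 ggP) _.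
    have := ler_wpM2l (ltW be0) lv'; lra.
  - apply: le_trans (nD _ _) _; apply: le_trans (lerD (fgd _) (fgd _)) _.
    have := ler_wpM2l d0 (le_trans dPQ P3); lra.
  - apply: le_trans (nD _ _) _; apply: le_trans (lerD (gfd _) (gfd _)) _.
    have := ler_wpM2l d0 (le_trans dPQ P4); lra.
pose K := C * (al * u + be * v) / l.
have K0 : 0 <= K.
  by rewrite divr_ge0 ?(ltW l0) // mulr_ge0 // ltW // addr_gt0 // mulr_gt0.
exists (nrm e + K); first by rewrite addr_ge0.
move=> [|n]; rewrite -/(t _); first by rewrite expr0 mulr1 lerDl.
have [h1 h2 _ _] := key n.
apply: le_trans (_ : K * l ^+ n.+1 <= _); last first.
  by rewrite ler_wpM2r ?exprn_ge0 ?(ltW l0) // lerDr.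
rewrite exprS /K mulrA divfK ?gt_eqF //.
apply: le_trans (nD _ _) _; apply: le_trans (lerD h1 h2) _.
by move: (l ^+ n) => L; lra.
Qed.

Section SumNorm.
Context (R : realType) (A : cstarAlgType R) (V : hilbertModType A).
Implicit Types (x y z : V).

Definition theta_norm x y : R := opnorm (diag (inner x y) (theta x y)).

Lemma hnorm_diag_theta x y (w : A * V) :
  hnorm (diag (inner x y) (theta x y) w) <= theta_norm x y * hnorm w.
Proof. by apply: linking_opnorm; apply: linking_diag; exact: compact_theta. Qed.

Lemma theta_norm_le x y : theta_norm x y <= rnorm x * rnorm y.
Proof.
apply: opnorm_le => [|w]; first by rewrite mulr_ge0 ?rnorm_ge0.
apply: hnorm_le_pf => [|psi pf]; first by rewrite mulr_ge0 ?rnorm_ge0.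
rewrite !inner_pair /= addr0 add0r !(pfD pf) !raddfD /= mulrDr exprMn lerD //.
  have -> : inner (lmul (inner x y) w.1) (lmul (inner x y) w.1) =
      cmul (cstar (inner x (ract y w.1))) (inner x (ract y w.1)) :> A.
    by rewrite (@inner_ract _ _ V).
  apply: le_trans (pf_inner_le pf _ _) _; rewrite -[X in _ <= X]mulrA.
  by apply: ler_wpM2l; [exact: sqr_ge0|exact: pf_ract_le].
apply: le_trans (pf_ract_le pf _ _) _; rewrite -[X in _ <= X]mulrA.
by apply: ler_wpM2l; [exact: sqr_ge0|exact: pf_inner_le].
Qed.

Lemma theta_norm_ge0 x y : 0 <= theta_norm x y.
Proof. exact: opnorm_ge0 (hnorm_diag_theta x y). Qed.

Lemma rnorm_inner_cmul x y (c : A) :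
  rnorm (cmul (inner x y) c) <= theta_norm x y * rnorm c.
Proof.
have := hnorm_diag_theta x y (c, 0) => le.
apply: le_trans (_ : rnorm (diag (inner x y) (theta x y) (c, 0)).1 <= _).
  by rewrite /= addr0.
apply: le_trans (hnorm_fst _) _; apply: le_trans le _.
rewrite ler_wpM2l ?theta_norm_ge0 //.
by apply: le_trans (hnorm_pair_le _) _; rewrite /= rnorm0 addr0.
Qed.

Lemma rnorm_theta x y z : rnorm (theta x y z) <= theta_norm x y * rnorm z.
Proof.
have := hnorm_diag_theta x y (0, z) => le.
apply: le_trans (_ : rnorm (diag (inner x y) (theta x y) (0, z)).2 <= _).
  by rewrite /= add0r.
apply: le_trans (hnorm_snd _) _; apply: le_trans le _.
rewrite ler_wpM2l ?theta_norm_ge0 //.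
by apply: le_trans (hnorm_pair_le _) _; rewrite /= rnorm0 add0r.
Qed.

(** [<y, x>] is the adjoint of [<x, y>], so the C*-identity carries the bound over. *)
Lemma rnorm_inner_cmulC x y (c : A) :
  rnorm (cmul (inner y x) c) <= theta_norm x y * rnorm c.
Proof.
apply: le_trans (rnormM _ _) _; rewrite ler_wpM2r ?rnorm_ge0 //.
have := rnorm_inner_cmul x y (inner y x).
have -> : cmul (inner x y) (inner y x) = cmul (cstar (inner y x)) (inner y x) :> A.
  by rewrite inner_star.
rewrite rnorm_starM expr2; have [->|g0] := eqVneq (rnorm (inner y x : A)) 0.
  by rewrite theta_norm_ge0.
by rewrite ler_pM2r // lt_def g0 rnorm_ge0.
Qed.

Lemma rnorm_thetaC x y z : rnorm (theta y x z) <= theta_norm x y * rnorm z.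
Proof.
have [->|t0] := eqVneq (rnorm (theta y x z)) 0.
  by rewrite mulr_ge0 ?theta_norm_ge0 ?rnorm_ge0.
have t1 : 0 < rnorm (theta y x z) by rewrite lt_def t0 rnorm_ge0.
rewrite -(ler_pM2r t1) -expr2 -rnorm_inner theta_adjoint.
apply: le_trans (rnorm_inner_le _ _) _; rewrite mulrC mulrAC.
by rewrite ler_wpM2r ?rnorm_ge0 ?rnorm_theta.
Qed.

(** A positive vector [(u, v)] sent below [l] times itself is enough; no exact eigenvector is
    required. The composite [swap x \o swap y] is [diag (inner x y) (theta x y)], the source of
    [d ^+ 2]. *)
Lemma norm_sum_le x y (d u v l : R) : 0 < rnorm x -> 0 < rnorm y -> 0 <= d ->
  d ^+ 2 = theta_norm x y -> 0 < u -> 0 < v ->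
  rnorm x * u + d * v <= l * u -> d * u + rnorm y * v <= l * v ->
  rnorm (x + y) <= l.
Proof.
move=> x0 y0 d0 dE u0 v0 lu lv.
have l0 : 0 < l.
  rewrite -(pmulr_lgt0 _ u0); apply: lt_le_trans lu; rewrite ltr_pwDl ?mulr_gt0 //.
  by rewrite mulr_ge0 // ltW.
pose nrm (w : A * V) := rnorm w.1 + rnorm w.2.
pose h : A := inner (x + y) (x + y).
have swap_le z w : nrm (swap z w) <= rnorm z * nrm w.
  rewrite /nrm /= add0r addr0 addrC mulrDr lerD //; first exact: rnorm_ract.
  exact: rnorm_inner_le.
have swapD z w w' : swap z (w + w') = swap z w + swap z w'.
  congr pair => /=; first by rewrite !add0r /lmap innerDr.
  by rewrite !addr0 /rmap ractDr.
have [|||||C C0 CP] := @sum_iter_bound R (A * V)%type nrm (swap x) (swap y)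
  (rnorm x) (rnorm y) d u v l (h, 0) _ _ (swapD x) (swapD y)
  (swap_le x) (swap_le y) _ _ x0 y0 d0 _ u0 v0 lu lv.
- by move=> z w; rewrite /nrm /= addrACA lerD // rnormD.
- by move=> z; rewrite addr_ge0 ?rnorm_ge0.
- move=> w; rewrite dE /nrm /= !(add0r, addr0) mulrDr lerD //.
    by rewrite /lmap /rmap inner_ract rnorm_inner_cmul.
  exact: rnorm_theta.
- move=> w; rewrite dE /nrm /= !(add0r, addr0) mulrDr lerD //.
    by rewrite /lmap /rmap inner_ract rnorm_inner_cmulC.
  exact: rnorm_thetaC.
- by rewrite dE theta_norm_le.
pose T w := swap x w + swap y w.
have SV := hilbert_semi_inner V.
have TT c : T (T (c, 0)) = (cmul h c, 0).
  have E w : T w = swap (x + y) w.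
    congr pair => /=; first by rewrite !add0r /lmap (si_Dl SV).
    by rewrite !addr0 /rmap ractDl.
  rewrite !E; congr pair => /=; rewrite ?add0r ?addr0.
    by rewrite /lmap /rmap (@inner_ract _ _ V).
  by rewrite /lmap inner0r /rmap ract0r.
have iterE n : iter n.*2 T (h, 0) = (iter n (cmul h) h, 0).
  by elim: n => [//|n IH]; rewrite doubleS !iterS IH TT.
have US := cstar_seminorm_unitization A.
have embE n : emb (iter n (cmul h) h) = emb h ^+ n.+1.
  by elim: n => [|n IH]; [rewrite expr1|rewrite iterS embM IH -exprS].
have sh : ustar (emb h) = emb h by rewrite -emb_star /h inner_star.
suff : rnorm (x + y) ^+ 2 <= l ^+ 2.
  by rewrite ler_pXn2r ?nnegrE ?rnorm_ge0 ?(ltW l0).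
(* Starting from [(h, 0)] already provides one factor [h], so [2 (2 ^ k - 1)] iterations reach
   [h ^ (2 ^ k)]; dividing [C] by [l ^+ 2] makes up for the two missing ones. *)
apply: (@le_of_exp_bound _ _ _ (C / l ^+ 2)) => [||k]; first exact: sqr_ge0.
  by rewrite exprn_gt0.
have k0 : (0 < 2 ^ k)%N by rewrite expn_gt0.
have := CP (2 ^ k).-1.*2; rewrite iterE {1}/nrm /= rnorm0 addr0.
rewrite -unorm_emb embE prednK // (snormX2 US) // unorm_emb rnorm_inner.
move=> /le_trans; apply; rewrite -exprM.
have -> : (2 * 2 ^ k = (2 ^ k).-1.*2.+2)%N.
  by rewrite mul2n -{1}(prednK k0) doubleS.
rewrite -[_.*2.+2]addn2 exprD mulrA mulrAC mulfVK ?expf_neq0 ?gt_eqF //.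
Qed.

End SumNorm.

(** * Symmetric two by two matrices *)

Section SpectralNorm.
Context (R : realType) (a s b : R).
Context (a0 : 0 <= a) (b0 : 0 <= b) (sab : s ^+ 2 <= a * b).
Implicit Types (v : 'cV[R]_2).

Let M := mx22 a s s b.

Lemma l2norm2 v : l2norm v = Num.sqrt (v 0 0 ^+ 2 + v 1 0 ^+ 2).
Proof.
rewrite /l2norm !big_ord_recl big_ord0 addr0.
by congr (Num.sqrt (_ + v _ _ ^+ _)); apply/val_inj.
Qed.

Lemma l2norm_mx22 v : l2norm (M *m v) =
  Num.sqrt ((a * v 0 0 + s * v 1 0) ^+ 2 + (s * v 0 0 + b * v 1 0) ^+ 2).
Proof.
rewrite l2norm2 !mxE !big_ord_recl !big_ord0 !mxE /= !addr0.
by have -> : lift ord0 ord0 = 1 :> 'I_2 by apply/val_inj.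
Qed.

Lemma l2norm_mx22_le v : l2norm (M *m v) <= (a + b) * l2norm v.
Proof.
rewrite l2norm_mx22 l2norm2; move: (v 0 0) (v 1 0) => p q.
rewrite -[a + b]ger0_norm ?addr_ge0 // -sqrtr_sqr -sqrtrM ?sqr_ge0 //.
apply: ler_wsqrtr.
(* This is the quadratic form of [(a + b) I - M], the adjugate of [M]; it is nonnegative because
   [s ^+ 2 <= a * b]. *)
have key : 0 <= b * p ^+ 2 + a * q ^+ 2 - 2 * s * p * q.
  have [a00|an0] := eqVneq a 0.
    have -> : s = 0.
      apply/eqP; rewrite -sqrf_eq0 eq_le sqr_ge0 andbT.
      by rewrite (le_trans sab) // a00 mul0r.
    by have := mulr_ge0 b0 (sqr_ge0 p); rewrite a00; lra.
  have a1 : 0 < a by rewrite lt_def an0.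
  rewrite -(pmulr_rge0 _ a1).
  by have := sqr_ge0 (s * p - a * q); have := ler_wpM2r (sqr_ge0 p) sab; nra.
have := mulr_ge0 (addr_ge0 a0 b0) key.
have := ler_wpM2r (sqr_ge0 p) sab; have := ler_wpM2r (sqr_ge0 q) sab.
by move=> h1 h2 h3; nra.
Qed.

Lemma specnorm_le : specnorm M <= a + b.
Proof.
apply: ge_sup => [|_ [v v1 <-]].
  exists (l2norm (M *m 0)); exists 0 => //=.
  by rewrite l2norm2 !mxE expr0n addr0 sqrtr0.
by rewrite (le_trans (l2norm_mx22_le v)) // ler_piMr // addr_ge0.
Qed.

Lemma eigenvalue_le_specnorm (u v l : R) : 0 < u ^+ 2 + v ^+ 2 -> 0 <= l ->
  a * u + s * v = l * u -> s * u + b * v = l * v -> l <= specnorm M.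
Proof.
move=> uv l0 e1 e2; pose r := Num.sqrt (u ^+ 2 + v ^+ 2).
have r0 : 0 < r by rewrite sqrtr_gt0.
have r2 : r ^+ 2 = u ^+ 2 + v ^+ 2 by rewrite sqr_sqrtr // ltW.
pose w : 'cV[R]_2 := \col_i (if i == 0 then u / r else v / r).
have w0 : w 0 0 = u / r by rewrite mxE.
have w1 : w 1 0 = v / r by rewrite mxE.
have uvr : (u / r) ^+ 2 + (v / r) ^+ 2 = 1.
  by rewrite !expr_div_n -mulrDl -r2 divff // expf_neq0 // gt_eqF.
have Mw : l2norm (M *m w) = l.
  rewrite l2norm_mx22 w0 w1.
  have -> : a * (u / r) + s * (v / r) = l * (u / r) by rewrite !mulrA -mulrDl e1.
  have -> : s * (u / r) + b * (v / r) = l * (v / r) by rewrite !mulrA -mulrDl e2.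
  by rewrite !(exprMn _ l) -mulrDr uvr mulr1 sqrtr_sqr ger0_norm.
rewrite -Mw; apply: ub_le_sup.
  exists (a + b) => _ [z z1 <-].
  by rewrite (le_trans (l2norm_mx22_le z)) // ler_piMr // addr_ge0.
by exists w => //=; rewrite l2norm2 w0 w1 uvr sqrtr1.
Qed.

End SpectralNorm.

Theorem theorem2p13 (R : realType) (A : cstarAlgType R)
    (A_nonzero : exists a : A, a != 0)
    (V : hilbertModType A) (x y : V) :
  let D : A * V -> A * V := blockop (lmul (inner x y)) 0 0 (theta x y) in
  let s : R := 2^-1 * Num.sqrt (opnorm D) in
  let N : R := specnorm (mx22 (Omega x) s s (Omega y)) in
  Omega (x + y) <= N /\ N <= Omega x + Omega y.
Proof.
move=> D s N; rewrite {}/N !OmegaE.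
pose a := rnorm x; pose b := rnorm y; pose d := Num.sqrt (theta_norm x y).
have sE : s = d / 2 by rewrite mulrC.
have a0 : 0 <= a by exact: rnorm_ge0.
have b0 : 0 <= b by exact: rnorm_ge0.
have d0 : 0 <= d by exact: sqrtr_ge0.
have d2 : d ^+ 2 = theta_norm x y by rewrite sqr_sqrtr // theta_norm_ge0.
have dab : d ^+ 2 <= a * b by rewrite d2 theta_norm_le.
rewrite {}sE -/a -/b; set N := specnorm _.
have a2 : 0 <= a / 2 by lra.
have b2 : 0 <= b / 2 by lra.
have sab : (d / 2) ^+ 2 <= a / 2 * (b / 2).
  by move: dab; rewrite !expr2; lra.
split; last exact: specnorm_le.
have eig := eigenvalue_le_specnorm a2 b2 sab; rewrite -/N in eig.
(* The matrix is then diagonal, and the eigenvector [(d, v)] used below could vanish or lie on an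
   axis. *)
have eigd0 : d = 0 -> a / 2 <= N /\ b / 2 <= N.
  move=> dd; split.
    by apply: (eig 1 0) => //; rewrite ?dd; lra.
  by apply: (eig 0 1) => //; rewrite ?dd; lra.
have dz : a * b = 0 -> d = 0.
  move=> ab; apply/eqP; rewrite -sqrf_eq0 eq_le sqr_ge0 andbT.
  by rewrite (le_trans dab) // ab.
have [x0|x0] := eqVneq a 0.
  rewrite (rnorm_eq0 x0) add0r -/b.
  by have [] := eigd0 (dz _); rewrite ?x0 ?mul0r.
have [y0|y0] := eqVneq b 0.
  rewrite (rnorm_eq0 y0) addr0 -/a.
  by have [] := eigd0 (dz _); rewrite ?y0 ?mulr0.
have a1 : 0 < a by rewrite lt_def x0.
have b1 : 0 < b by rewrite lt_def y0.
suff : rnorm (x + y) <= 2 * N by lra.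
have [dd|dn0] := eqVneq d 0.
  have [aN bN] := eigd0 dd.
  by apply: (norm_sum_le a1 b1 d0 d2 ltr01 ltr01); rewrite dd; lra.
have d1 : 0 < d by rewrite lt_def dn0.
pose r := Num.sqrt ((a - b) ^+ 2 + 4 * d ^+ 2).
have r2 : r ^+ 2 = (a - b) ^+ 2 + 4 * d ^+ 2.
  by rewrite sqr_sqrtr // addr_ge0 ?sqr_ge0 // mulr_ge0 ?sqr_ge0.
have r0 : 0 <= r by exact: sqrtr_ge0.
have rab : a - b < r by have := exprn_gt0 2 d1; nra.
have rba : b - a < r by have := exprn_gt0 2 d1; nra.
(* [l] is the larger root of [(l - a) (l - b) = d ^ 2] and [v = l - a], so [(d, v)] is an
   eigenvector of [[[a, d], [d, b]]]; [d > 0] makes both coordinates positive. *)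
pose v := (b - a + r) / 2; pose l := (a + b + r) / 2.
have v0 : 0 < v by rewrite /v; lra.
have e1 : a * d + d * v = l * d by rewrite /l /v; lra.
have e2 : d * d + b * v = l * v by move: r2; rewrite /l /v !expr2; lra.
have lN : l / 2 <= N.
  apply: (eig d v); [|by rewrite /l; lra|lra|lra].
  by rewrite addr_gt0 // exprn_gt0.
have lu : a * d + d * v <= 2 * N * d by rewrite e1 ler_pM2r //; lra.
have lv : d * d + b * v <= 2 * N * v by rewrite e2 ler_pM2r //; lra.
exact: (norm_sum_le a1 b1 d0 d2 d1 v0 lu lv).
Qed.
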